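(* Assume that $\mathbb{F}$ is algebraically closed and $q$ is not a root of unity. Let $d\geq1$ be an odd integer. If $V$ is a $(d+1)$-dimensional irreducible $\mathfrak{H}_q$-module, then there exist an element $\varepsilon\in\mathbb{Z}/4\mathbb{Z}$ and nonzero scalars $k_0,k_1,k_2,k_3\in\mathbb{F}$ with $k_0^2=q^{-d-1}$ such that the $\mathfrak{H}_q$-module $E(k_0,k_1,k_2,k_3)^\varepsilon$ is isomorphic to $V$.
   Context: $\mathbb{F}$ is a field and $q\in\mathbb{F}$ is nonzero. The universal DAHA $\mathfrak{H}_q$ of type $(C_1^\vee,C_1)$ is the unital associative $\mathbb{F}$-algebra with generators $t_0^{\pm1},t_1^{\pm1},t_2^{\pm1},t_3^{\pm1}$ and relations: $t_it_i^{-1}=t_i^{-1}t_i=1$ for all $i$; $t_i+t_i^{-1}$ is central for all $i$; $t_0t_1t_2t_3=q^{-1}$. The group $\mathbb{Z}/4\mathbb{Z}$ acts on $\mathfrak{H}_q$ by $\mathbb{F}$-algebra automorphisms: $\varepsilon\in\mathbb{Z}/4\mathbb{Z}$ sends $t_i\mapsto t_{i+\varepsilon}$ (indices mod $4$). For an $\mathfrak{H}_q$-module $V$, $V^\varepsilon$ denotes the module obtained by twisting $V$ via $\varepsilon$: the same vector space, with $x\in\mathfrak{H}_q$ acting on $V^\varepsilon$ as $\varepsilon(x)$ acts on $V$. For an odd integer $d\ge1$ and nonzero $k_0,k_1,k_2,k_3\in\mathbb{F}$ with $k_0^2=q^{-d-1}$, $E(k_0,k_1,k_2,k_3)$ denotes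 the $(d+1)$-dimensional $\mathfrak{H}_q$-module with $\mathbb{F}$-basis $\{v_i\}_{i=0}^d$ and action - $t_0v_i=k_0^{-1}q^{-i}(1-q^i)(1-k_0^2q^i)v_{i-1}+(k_0+k_0^{-1}-k_0^{-1}q^{-i})v_i$ for $i=2,4,\ldots,d-1$; $t_0v_i=k_0^{-1}q^{-i-1}(v_i-v_{i+1})$ for $i=1,3,\ldots,d-2$; $t_0v_0=k_0v_0$; $t_0v_d=k_0v_d$; - $t_1v_i=-k_1(1-q^i)(1-k_0^2q^i)v_{i-1}+k_1v_i+k_1^{-1}v_{i+1}$ for $i=2,4,\ldots,d-1$; $t_1v_i=k_1^{-1}v_i$ for $i=1,3,\ldots,d$; $t_1v_0=k_1v_0+k_1^{-1}v_1$; - $t_2v_i=k_0^{-1}k_1^{-1}k_3^{-1}q^{-i-1}(v_i-v_{i+1})$ for $i=0,2,\ldots,d-1$; $t_2v_i=\frac{(k_0k_1k_3q^i-k_2)(k_0k_1k_3q^i-k_2^{-1})}{k_0k_1k_3q^i}v_{i-1}+(k_2+k_2^{-1}-k_0^{-1}k_1^{-1}k_3^{-1}q^{-i})v_i$ for $i=1,3,\ldots,d$; - $t_3v_i=k_3v_i$ for $i=0,2,\ldots,d-1$; $t_3v_i=-k_3^{-1}(k_0k_1k_3q^i-k_2)(k_0k_1k_3q^i-k_2^{-1})v_{i-1}+k_3^{-1}v_i+k_3v_{i+1}$ for $i=1,3,\ldots,d-2$; $t_3v_d=-k_3^{-1}(k_0k_1k_3q^d-k_2)(k_0k_1k_3q^d-k_2^{-1})v_{d-1}+k_3^{-1}v_d$.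 (These formulas do define an $\mathfrak{H}_q$-module.) *)

(* Defs.v *)
From HB Require Import structures.
From mathcomp Require Import all_boot all_order all_algebra.
From mathcomp Require Import boolp.
From mathcomp Require Import ring.
Set Implicit Arguments.
Unset Strict Implicit.
Unset Printing Implicit Defensive.
Import GRing.Theory.
Local Open Scope ring_scope.
Local Open Scope quotient_scope.

(* Noncommutative polynomial expressions; [DGen i false] stands for the
   generator t_i and [DGen i true] for the generator t_i^-1. *)
Inductive daha_expr (F : Type) : Type :=
  | DConst of F
  | DGen of 'Z_4 & bool
  | DAdd of daha_expr F & daha_expr F
  | DMul of daha_expr F & daha_expr F.
Arguments DGen {F}.

HB.instance Definition _ (F : Type) := gen_eqMixin (daha_expr F).
HB.instance Definition _ (F : Type) := gen_choiceMixin (daha_expr F).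

(* The least congruence on expressions that contains the axioms of unital
   associative F-algebras and the defining relations (the last four
   constructors). *)
Inductive daha_rel (F : fieldType) (q : F) :
    daha_expr F -> daha_expr F -> Prop :=
  | DRrefl x : daha_rel q x x
  | DRsym x y : daha_rel q x y -> daha_rel q y x
  | DRtrans x y z : daha_rel q x y -> daha_rel q y z -> daha_rel q x z
  | DRadd x x' y y' : daha_rel q x x' -> daha_rel q y y' ->
      daha_rel q (DAdd x y) (DAdd x' y')
  | DRmul x x' y y' : daha_rel q x x' -> daha_rel q y y' ->
      daha_rel q (DMul x y) (DMul x' y')
  | DRaddA x y z : daha_rel q (DAdd x (DAdd y z)) (DAdd (DAdd x y) z)
  | DRaddC x y : daha_rel q (DAdd x y) (DAdd y x)
  | DRadd0 x : daha_rel q (DAdd (DConst 0) x) x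
  | DRaddN x : daha_rel q (DAdd (DMul (DConst (-1)) x) x) (DConst 0)
  | DRmulA x y z : daha_rel q (DMul x (DMul y z)) (DMul (DMul x y) z)
  | DRmul1l x : daha_rel q (DMul (DConst 1) x) x
  | DRmul1r x : daha_rel q (DMul x (DConst 1)) x
  | DRmulDl x y z :
      daha_rel q (DMul (DAdd x y) z) (DAdd (DMul x z) (DMul y z))
  | DRmulDr x y z :
      daha_rel q (DMul x (DAdd y z)) (DAdd (DMul x y) (DMul x z))
  | DRconstD a b : daha_rel q (DConst (a + b)) (DAdd (DConst a) (DConst b))
  | DRconstM a b : daha_rel q (DConst (a * b)) (DMul (DConst a) (DConst b))
  | DRconstC a x : daha_rel q (DMul (DConst a) x) (DMul x (DConst a))
  | DRinvr i : daha_rel q (DMul (DGen i false) (DGen i true)) (DConst 1)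
  | DRinvl i : daha_rel q (DMul (DGen i true) (DGen i false)) (DConst 1)
  | DRcentral i x :
      daha_rel q (DMul (DAdd (DGen i false) (DGen i true)) x)
                 (DMul x (DAdd (DGen i false) (DGen i true)))
  | DRprod :
      daha_rel q (DMul (DMul (DMul (DGen 0 false) (DGen 1 false))
                             (DGen 2%:R false)) (DGen 3%:R false))
                 (DConst q^-1).

(* The defining relations, for a tuple of elements of an arbitrary algebra. *)
Definition daha_relations (F : fieldType) (q : F) (A : algType F)
    (u : 'Z_4 -> bool -> A) : Prop :=
  [/\ forall i, u i false * u i true = 1,
      forall i, u i true * u i false = 1,
      forall i j b, (u i false + u i true) * u j b =
                    u j b * (u i false + u i true) &
      u 0 false * u 1 false * u 2%:R false * u 3%:R false = q^-1%:A].

Fixpoint daha_eval (F : fieldType) (A : algType F) (u : 'Z_4 -> bool -> A)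
    (x : daha_expr F) : A :=
  match x with
  | DConst a => a%:A
  | DGen i b => u i b
  | DAdd x y => daha_eval u x + daha_eval u y
  | DMul x y => daha_eval u x * daha_eval u y
  end.

Lemma daha_eval_rel (F : fieldType) (q : F) (A : algType F)
    (u : 'Z_4 -> bool -> A) (hu : daha_relations q u) (x y : daha_expr F) :
  daha_rel q x y -> daha_eval u x = daha_eval u y.
Proof.
case: hu => hr hl hc hp; elim=> //=.
- by move=> ? ? ? _ -> _ ->.
- by move=> ? ? ? ? _ -> _ ->.
- by move=> ? ? ? ? _ -> _ ->.
- by move=> ? ? ?; rewrite addrA.
- by move=> ? ?; rewrite addrC.
- by move=> ?; rewrite scale0r add0r.
- by move=> ?; rewrite scaleN1r mulN1r addNr scale0r.
- by move=> ? ? ?; rewrite mulrA.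
- by move=> ?; rewrite scale1r mul1r.
- by move=> ?; rewrite scale1r mulr1.
- by move=> ? ? ?; rewrite mulrDl.
- by move=> ? ? ?; rewrite mulrDr.
- by move=> ? ?; rewrite scalerDl.
- by move=> ? ?; rewrite -scalerAl mul1r scalerA.
- by move=> ? ?; rewrite -scalerAl -scalerAr mul1r mulr1.
- by move=> ?; rewrite scale1r; apply: hr.
- by move=> ?; rewrite scale1r; apply: hl.
- move=> i; elim=> [a|j b|x1 IH1 x2 IH2|x1 IH1 x2 IH2] /=.
  + by rewrite -scalerAl -scalerAr mul1r mulr1.
  + exact: hc.
  + by rewrite mulrDr IH1 IH2 mulrDl.
  + by rewrite mulrA IH1 -mulrA IH2 mulrA.
Qed.

Section DAHA.
Variables (F : fieldType) (q : F).

Definition daha_relb (x y : daha_expr F) : bool := `[< daha_rel q x y >].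

Lemma daha_relb_equiv : equiv_class_of daha_relb.
Proof.
split=> [x|x y|y x z].
- exact/asboolP/DRrefl.
- by apply/asboolP/asboolP; exact: DRsym.
- by move=> /asboolP h1 /asboolP h2; apply/asboolP; exact: DRtrans h1 h2.
Qed.

Canonical daha_relb_equiv_rel := EquivRelPack daha_relb_equiv.
Canonical daha_relb_encModRel := defaultEncModRel daha_relb.

(* The nonvanishing of q enters only through the proof that 1 != 0. *)
Definition daha (hq : q != 0) : Type := {eq_quot daha_relb}.

Variable hq : q != 0.
Local Notation H := (daha hq).

HB.instance Definition _ := EqQuotient.on H.
HB.instance Definition _ := Choice.on H.

Lemma daha_piP (x y : daha_expr F) :
  reflect (\pi_H x = \pi_H y) `[< daha_rel q x y >].
Proof. by apply: (iffP idP) => [h|/eqP]; [apply/eqP|]; rewrite piE. Qed.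

Lemma daha_pi_eq (x y : daha_expr F) : daha_rel q x y -> \pi_H x = \pi_H y.
Proof. by move=> h; apply/daha_piP/asboolP. Qed.

Lemma daha_repr (x : daha_expr F) : daha_rel q (repr (\pi_H x)) x.
Proof. by apply/asboolP/daha_piP; rewrite reprK. Qed.

Definition daha_const (a : F) : H := \pi_H (DConst a).
Definition daha_gen (i : 'Z_4) (b : bool) : H := \pi_H (DGen i b).
Definition daha_add (x y : H) : H := \pi_H (DAdd (repr x) (repr y)).
Definition daha_mul (x y : H) : H := \pi_H (DMul (repr x) (repr y)).
Definition daha_opp (x : H) : H := daha_mul (daha_const (-1)) x.

Lemma daha_addE x y : daha_add (\pi_H x) (\pi_H y) = \pi_H (DAdd x y).
Proof. by apply/daha_pi_eq/DRadd; apply: daha_repr. Qed.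

Lemma daha_mulE x y : daha_mul (\pi_H x) (\pi_H y) = \pi_H (DMul x y).
Proof. by apply/daha_pi_eq/DRmul; apply: daha_repr. Qed.

Definition dahaE := (daha_addE, daha_mulE).

Lemma daha_ind (P : H -> Prop) : (forall x, P (\pi_H x)) -> forall x, P x.
Proof. by move=> h x; rewrite -[x]reprK. Qed.

Lemma daha_addA : associative daha_add.
Proof.
elim/daha_ind=> x; elim/daha_ind=> y; elim/daha_ind=> z.
by rewrite !dahaE; apply/daha_pi_eq/DRaddA.
Qed.

Lemma daha_addC : commutative daha_add.
Proof.
elim/daha_ind=> x; elim/daha_ind=> y.
by rewrite !dahaE; apply/daha_pi_eq/DRaddC.
Qed.

Lemma daha_add0 : left_id (daha_const 0) daha_add.
Proof. by elim/daha_ind=> x; rewrite !dahaE; apply/daha_pi_eq/DRadd0. Qed.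

Lemma daha_addN : left_inverse (daha_const 0) daha_opp daha_add.
Proof.
elim/daha_ind=> x.
by rewrite /daha_opp /daha_const !dahaE; apply/daha_pi_eq/DRaddN.
Qed.

Lemma daha_mulA : associative daha_mul.
Proof.
elim/daha_ind=> x; elim/daha_ind=> y; elim/daha_ind=> z.
by rewrite !dahaE; apply/daha_pi_eq/DRmulA.
Qed.

Lemma daha_mul1l : left_id (daha_const 1) daha_mul.
Proof. by elim/daha_ind=> x; rewrite !dahaE; apply/daha_pi_eq/DRmul1l. Qed.

Lemma daha_mul1r : right_id (daha_const 1) daha_mul.
Proof. by elim/daha_ind=> x; rewrite !dahaE; apply/daha_pi_eq/DRmul1r. Qed.

Lemma daha_mulDl : left_distributive daha_mul daha_add.
Proof.
elim/daha_ind=> x; elim/daha_ind=> y; elim/daha_ind=> z.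
by rewrite !dahaE; apply/daha_pi_eq/DRmulDl.
Qed.

Lemma daha_mulDr : right_distributive daha_mul daha_add.
Proof.
elim/daha_ind=> x; elim/daha_ind=> y; elim/daha_ind=> z.
by rewrite !dahaE; apply/daha_pi_eq/DRmulDr.
Qed.

(* H_q maps onto F by t_0 |-> q^-1 and t_1, t_2, t_3 |-> 1. *)
Lemma daha_oneN0 : daha_const 1 != daha_const 0.
Proof.
apply/eqP => /daha_piP/asboolP h.
pose u (i : 'Z_4) (b : bool) : F^o :=
  if i == 0 then (if b then q else q^-1) else 1.
have hu : daha_relations q u.
  split=> [i|i|i j b|]; rewrite /u /=.
  - by case: eqP => _; rewrite ?mulr1 ?mulVf.
  - by case: eqP => _; rewrite ?mulr1 ?mulfV.
  - exact: mulrC.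
  - by rewrite !mulr1 /GRing.scale /= mulr1.
have := daha_eval_rel hu h; rewrite /= scale1r scale0r => /eqP.
by rewrite oner_eq0.
Qed.

HB.instance Definition _ :=
  GRing.isZmodule.Build H daha_addA daha_addC daha_add0 daha_addN.
HB.instance Definition _ :=
  GRing.Zmodule_isNzRing.Build H daha_mulA daha_mul1l daha_mul1r
    daha_mulDl daha_mulDr daha_oneN0.

Definition daha_scale (a : F) (x : H) : H := daha_const a * x.

Lemma daha_constM a b : daha_const (a * b) = daha_const a * daha_const b.
Proof. by rewrite /GRing.mul /= !dahaE; apply/daha_pi_eq/DRconstM. Qed.

Lemma daha_constD a b : daha_const (a + b) = daha_const a + daha_const b.
Proof. by rewrite [RHS]/GRing.add /= !dahaE; apply/daha_pi_eq/DRconstD. Qed.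

Lemma daha_constC a x : daha_const a * x = x * daha_const a.
Proof.
elim/daha_ind: x => x.
by rewrite /GRing.mul /= !dahaE; apply/daha_pi_eq/DRconstC.
Qed.

Lemma daha_scaleA a b x :
  daha_scale a (daha_scale b x) = daha_scale (a * b) x.
Proof. by rewrite /daha_scale daha_constM mulrA. Qed.

Lemma daha_scale1 : left_id 1 daha_scale.
Proof. by move=> x; rewrite /daha_scale mul1r. Qed.

Lemma daha_scaleDr : right_distributive daha_scale +%R.
Proof. by move=> a x y; rewrite /daha_scale mulrDr. Qed.

Lemma daha_scaleDl x : {morph daha_scale^~ x : a b / a + b}.
Proof. by move=> a b; rewrite /daha_scale daha_constD mulrDl. Qed.

HB.instance Definition _ :=
  GRing.Zmodule_isLmodule.Build F H daha_scaleA daha_scale1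
    daha_scaleDr daha_scaleDl.

Lemma daha_scaleAl (a : F) (x y : H) : a *: (x * y) = a *: x * y.
Proof. by rewrite /GRing.scale /= /daha_scale mulrA. Qed.

HB.instance Definition _ := GRing.Lmodule_isLalgebra.Build F H daha_scaleAl.

Lemma daha_scaleAr (a : F) (x y : H) : a *: (x * y) = x * (a *: y).
Proof. by rewrite /GRing.scale /= /daha_scale mulrA daha_constC mulrA. Qed.

HB.instance Definition _ := GRing.Lalgebra_isAlgebra.Build F H daha_scaleAr.

Lemma daha_algE (a : F) : a%:A = daha_const a :> H.
Proof. by rewrite /GRing.scale /= /daha_scale mulr1. Qed.

Lemma daha_piD x y : \pi_H (DAdd x y) = \pi_H x + \pi_H y.
Proof. by rewrite -daha_addE. Qed.

Lemma daha_piM x y : \pi_H (DMul x y) = \pi_H x * \pi_H y.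
Proof. by rewrite -daha_mulE. Qed.

Lemma daha_gen_relations : daha_relations q daha_gen.
Proof.
split=> [i|i|i j b|].
- by rewrite -daha_piM; apply/daha_pi_eq/DRinvr.
- by rewrite -daha_piM; apply/daha_pi_eq/DRinvl.
- by rewrite -daha_piD -!daha_piM; apply/daha_pi_eq/DRcentral.
- by rewrite daha_algE; have := daha_pi_eq (DRprod q); rewrite !daha_piM.
Qed.

Section Lift.
Variables (A : algType F) (u : 'Z_4 -> bool -> A) (hu : daha_relations q u).

Definition daha_lift of daha_relations q u := fun x : H => daha_eval u (repr x).
Local Notation f := (daha_lift hu).

Lemma daha_lift_pi x : f (\pi_H x) = daha_eval u x.
Proof. exact/daha_eval_rel/daha_repr. Qed.

Lemma daha_lift_gen i b : f (daha_gen i b) = u i b.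
Proof. by rewrite daha_lift_pi. Qed.

Lemma daha_lift_linear : linear f.
Proof.
move=> a; elim/daha_ind=> x; elim/daha_ind=> y.
rewrite [X in f (X + _)]/GRing.scale /= /daha_scale -daha_piM -daha_piD.
by rewrite !daha_lift_pi /= -scalerAl mul1r.
Qed.

Lemma daha_lift_monoid_morphism : monoid_morphism f.
Proof.
split; first by rewrite daha_lift_pi /= scale1r.
elim/daha_ind=> x; elim/daha_ind=> y.
by rewrite -daha_piM !daha_lift_pi.
Qed.

HB.instance Definition _ :=
  GRing.isLinear.Build F H A *:%R f daha_lift_linear.
HB.instance Definition _ :=
  GRing.isMonoidMorphism.Build H A f daha_lift_monoid_morphism.

End Lift.

End DAHA.

Lemma daha_prod_rot (F : fieldType) (q : F) (A : algType F)
    (u : 'Z_4 -> bool -> A) (hu : daha_relations q u) :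
  u 1 false * u 2%:R false * u 3%:R false * u 0 false = q^-1%:A.
Proof.
case: hu => hr hl hc hp.
rewrite -[LHS]mul1r -(hl 0) -mulrA [X in _ * X]mulrA [u 0 false * _]mulrA.
by rewrite [u 0 false * (_ * _)]mulrA hp -scalerAl mul1r -scalerAr hl.
Qed.

Lemma daha_rot1 (F : fieldType) (q : F) (A : algType F)
    (u : 'Z_4 -> bool -> A) :
  daha_relations q u -> daha_relations q (fun i b => u (i + 1) b).
Proof.
move=> hu; have hp := daha_prod_rot hu; case: hu => hr hl hc _.
split=> [i|i|i j b|]; [exact: hr|exact: hl|exact: hc|].
rewrite -[RHS]hp.
by congr (_ * _ * _ * _); congr (u _ false); apply: val_inj.
Qed.

Lemma daha_rot_relations (F : fieldType) (q : F) (A : algType F)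
    (u : 'Z_4 -> bool -> A) (eps : 'Z_4) :
  daha_relations q u -> daha_relations q (fun i b => u (i + eps) b).
Proof.
move=> hu; rewrite -[eps]natr_Zp; elim: (val eps) => [|n /daha_rot1] /=.
  case: hu => hr hl hc hp.
  by split=> [i|i|i j b|]; rewrite !addr0.
congr (daha_relations q _); apply/funext => i; apply/funext => b.
by rewrite -addrA mulrS.
Qed.

Section Modules.
Variables (F : fieldType) (q : F) (hq : q != 0).
Local Notation H := (daha hq).

(* The F-algebra endomorphism t_i |-> t_(i + eps). *)
Definition daha_rot (eps : 'Z_4) : {lrmorphism H -> H} :=
  daha_lift (daha_rot_relations eps (daha_gen_relations hq)).

Lemma daha_rot_gen eps i b :
  daha_rot eps (daha_gen hq i b) = daha_gen hq (i + eps) b.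
Proof. exact: daha_lift_gen. Qed.

Lemma daha_morph_ext (A : algType F) (f g : {lrmorphism H -> A}) :
  (forall i b, f (daha_gen hq i b) = g (daha_gen hq i b)) -> f =1 g.
Proof.
move=> h; elim/daha_ind; elim=> [a|i b|x hx y hy|x hx y hy].
- by rewrite -[\pi_H _]/(daha_const hq a) -daha_algE !linearZ !rmorph1.
- exact: h.
- by rewrite daha_piD (rmorphD f) (rmorphD g) /= hx hy.
- by rewrite daha_piM (rmorphM f) (rmorphM g) /= hx hy.
Qed.

Lemma daha_rot0 : daha_rot 0 =1 id.
Proof.
by apply: (@daha_morph_ext H (daha_rot 0) idfun) => i b; rewrite daha_rot_gen addr0.
Qed.

Lemma daha_rotD e1 e2 x : daha_rot (e1 + e2) x = daha_rot e1 (daha_rot e2 x).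
Proof.
rewrite -[RHS]/((daha_rot e1 \o daha_rot e2) x).
apply: daha_morph_ext => i b.
by rewrite [RHS]/= !daha_rot_gen -addrA (addrC e1).
Qed.

Definition twist (eps : 'Z_4) (V : lmodType H) : Type := V.

Section Twist.
Variables (eps : 'Z_4) (V : lmodType H).

HB.instance Definition _ := GRing.Zmodule.on (twist eps V).

Definition twist_scale (x : H) (v : twist eps V) : twist eps V :=
  daha_rot eps x *: (v : V).

Lemma twist_scaleA x y v :
  twist_scale x (twist_scale y v) = twist_scale (x * y) v.
Proof. by rewrite /twist_scale scalerA rmorphM. Qed.

Lemma twist_scale1 : left_id 1 twist_scale.
Proof. by move=> v; rewrite /twist_scale rmorph1 scale1r. Qed.

Lemma twist_scaleDr : right_distributive twist_scale +%R.
Proof. by move=> x u v; rewrite /twist_scale scalerDr. Qed.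

Lemma twist_scaleDl v : {morph twist_scale^~ v : x y / x + y}.
Proof. by move=> x y; rewrite /twist_scale rmorphD scalerDl. Qed.

HB.instance Definition _ :=
  GRing.Zmodule_isLmodule.Build H (twist eps V) twist_scaleA twist_scale1
    twist_scaleDr twist_scaleDl.

End Twist.

(* The F-vector space underlying an H_q-module. *)
Definition underlying (V : lmodType H) : Type := V.

Section Underlying.
Variable V : lmodType H.

HB.instance Definition _ := GRing.Zmodule.on (underlying V).

Definition underlying_scale (a : F) (v : underlying V) : underlying V :=
  (a%:A : H) *: (v : V).

Lemma underlying_scaleA a b v :
  underlying_scale a (underlying_scale b v) = underlying_scale (a * b) v.
Proof.
by rewrite /underlying_scale !scalerA -scalerAl mul1r scalerA.
Qed.

Lemma underlying_scale1 : left_id 1 underlying_scale.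
Proof. by move=> v; rewrite /underlying_scale !scale1r. Qed.

Lemma underlying_scaleDr : right_distributive underlying_scale +%R.
Proof. by move=> a u v; rewrite /underlying_scale scalerDr. Qed.

Lemma underlying_scaleDl v : {morph underlying_scale^~ v : a b / a + b}.
Proof. by move=> a b; rewrite /underlying_scale !scalerDl. Qed.

HB.instance Definition _ :=
  GRing.Zmodule_isLmodule.Build F (underlying V) underlying_scaleA
    underlying_scale1 underlying_scaleDr underlying_scaleDl.

End Underlying.

Definition has_dimension (n : nat) (V : lmodType H) : Prop :=
  exists f : {linear underlying V -> 'rV[F]_n}, bijective f.

Definition irreducible_module (V : lmodType H) : Prop :=
  (exists v : V, v != 0) /\
  forall W : {pred V}, submod_closed W ->
    (forall v, v \in W -> v = 0) \/ (forall v, v \in W).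

Definition isomorphic_modules (V W : lmodType H) : Prop :=
  exists f : {linear V -> W}, bijective f.

End Modules.

Section EFormulas.
Variables (F : fieldType) (q : F) (d : nat) (k0 k1 k2 k3 : F).

Definition E_basis (i : nat) : 'cV[F]_d.+1 := \col_r (r == i :> nat)%:R.
Local Notation v := E_basis.

Definition E_t0 (i : nat) : 'cV[F]_d.+1 :=
  if i == 0%N then k0 *: v 0%N
  else if i == d then k0 *: v d
  else if odd i then (k0^-1 * q ^- i.+1) *: (v i - v i.+1)
  else (k0^-1 * q ^- i * (1 - q ^+ i) * (1 - k0 ^+ 2 * q ^+ i)) *: v i.-1
       + (k0 + k0^-1 - k0^-1 * q ^- i) *: v i.

Definition E_t1 (i : nat) : 'cV[F]_d.+1 :=
  if i == 0%N then k1 *: v 0%N + k1^-1 *: v 1%N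
  else if odd i then k1^-1 *: v i
  else - (k1 * (1 - q ^+ i) * (1 - k0 ^+ 2 * q ^+ i)) *: v i.-1
       + k1 *: v i + k1^-1 *: v i.+1.

Definition E_t2 (i : nat) : 'cV[F]_d.+1 :=
  if odd i then
    ((k0 * k1 * k3 * q ^+ i - k2) * (k0 * k1 * k3 * q ^+ i - k2^-1)
       / (k0 * k1 * k3 * q ^+ i)) *: v i.-1
    + (k2 + k2^-1 - k0^-1 * k1^-1 * k3^-1 * q ^- i) *: v i
  else (k0^-1 * k1^-1 * k3^-1 * q ^- i.+1) *: (v i - v i.+1).

Definition E_t3 (i : nat) : 'cV[F]_d.+1 :=
  if odd i then
    - (k3^-1 * (k0 * k1 * k3 * q ^+ i - k2)
             * (k0 * k1 * k3 * q ^+ i - k2^-1)) *: v i.-1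
    + k3^-1 *: v i + (if i == d then 0 else k3 *: v i.+1)
  else k3 *: v i.

Definition E_act (j : 'Z_4) : nat -> 'cV[F]_d.+1 :=
  nth E_t0 [:: E_t0; E_t1; E_t2; E_t3] j.

Definition E_par (j : 'Z_4) : F := nth 0 [:: k0; k1; k2; k3] j.

Definition E_mx (j : 'Z_4) : 'M[F]_d.+1 := \matrix_(r, i) E_act j i r 0.

(* The matrix of t_j (for [b = false]) or of t_j^-1 (for [b = true]); the
   latter is k_j + k_j^-1 - t_j because (t_j - k_j)(t_j - k_j^-1) = 0. *)
Definition E_gen (j : 'Z_4) (b : bool) : 'M[F]_d.+1 :=
  if b then (E_par j + (E_par j)^-1)%:M - E_mx j else E_mx j.

End EFormulas.

Record E_parameters (F : fieldType) (q : F) (d : nat) (k0 k1 k2 k3 : F) :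
    Prop := EParameters {
  E_k0_neq0 : k0 != 0;
  E_k1_neq0 : k1 != 0;
  E_k2_neq0 : k2 != 0;
  E_k3_neq0 : k3 != 0;
  E_k0_sqr : k0 ^+ 2 = q ^- d.+1
}.

Section ERelations.
Variables (F : fieldType) (q : F) (hq : q != 0) (d : nat) (hd : odd d).
Variables (k0 k1 k2 k3 : F) (hk : E_parameters q d k0 k1 k2 k3).
Local Notation v := (E_basis F d).
Local Notation T := (E_mx q d k0 k1 k2 k3).

(* The formulas hold for every i, with v_i = 0 for i > d. *)
Lemma E_basis_out i : (d < i)%N -> v i = 0.
Proof.
by move=> hi; apply/colP => r; rewrite !mxE ltn_eqF // (leq_trans _ hi).
Qed.

Lemma E_mx_basis_in j (i : nat) : (i <= d)%N ->
  T j *m v i = E_act q d k0 k1 k2 k3 j i.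
Proof.
move=> hi; apply/colP => r; rewrite !mxE.
rewrite (bigD1 (Ordinal (hi : (i < d.+1)%N))) //=.
rewrite !mxE eqxx mulr1 big1 ?addr0 // => s /negPf hs.
by rewrite !mxE -val_eqE /= in hs *; rewrite hs mulr0.
Qed.

Lemma E_mx_basis_out j (i : nat) : (d < i)%N -> T j *m v i = 0.
Proof. by move=> hi; rewrite E_basis_out // mulmx0. Qed.

Lemma E_T0 i : T 0 *m v i =
  if odd i then (k0^-1 * q ^- i.+1) *: (v i - v i.+1)
  else (k0^-1 * q ^- i * (1 - q ^+ i) * (1 - k0 ^+ 2 * q ^+ i)) *: v i.-1
       + (k0 + k0^-1 - k0^-1 * q ^- i) *: v i.
Proof.
case: (leqP i d) => hi.
  rewrite E_mx_basis_in //= /E_act /= /E_t0.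
  case: eqP => [->/=|i0].
    by rewrite expr0 subrr mulr0 mul0r scale0r invr1 mulr1 addrK add0r.
  case: eqP => [->|//]; rewrite hd (@E_basis_out d.+1) // subr0 -(E_k0_sqr hk).
  by rewrite expr2 mulKf ?(E_k0_neq0 hk).
rewrite E_mx_basis_out // (E_basis_out hi).
rewrite (@E_basis_out i.+1) 1?ltnW // subr0 !scaler0 addr0.
case: ifP => // hoi; move: hi; rewrite leq_eqVlt => /orP[/eqP <-|hi].
  by rewrite (E_k0_sqr hk) mulVf ?expf_neq0 // subrr mulr0 scale0r.
by rewrite E_basis_out ?scaler0 //; case: i hi {hoi}.
Qed.

Lemma E_T1 i : T 1 *m v i =
  if odd i then k1^-1 *: v i
  else - (k1 * (1 - q ^+ i) * (1 - k0 ^+ 2 * q ^+ i)) *: v i.-1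
       + k1 *: v i + k1^-1 *: v i.+1.
Proof.
case: (leqP i d) => hi.
  rewrite E_mx_basis_in //= /E_act /= /E_t1.
  case: eqP => [->/=|//].
  by rewrite expr0 subrr mulr0 mul0r oppr0 scale0r add0r.
rewrite E_mx_basis_out // (E_basis_out hi).
rewrite (@E_basis_out i.+1) 1?ltnW // !scaler0 !addr0.
case: ifP => // hoi; move: hi; rewrite leq_eqVlt => /orP[/eqP <-|hi].
  by rewrite (E_k0_sqr hk) mulVf ?expf_neq0 // subrr mulr0 oppr0 scale0r.
by rewrite E_basis_out ?scaler0 //; case: i hi {hoi}.
Qed.

Lemma E_pred_out i : odd i -> (d < i)%N -> (d < i.-1)%N.
Proof.
move=> hoi; rewrite leq_eqVlt => /orP[/eqP h|]; last by case: i {hoi}.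
by move: hoi; rewrite -h /= hd.
Qed.

Lemma E_T2 i : T 2%:R *m v i =
  if odd i then
    ((k0 * k1 * k3 * q ^+ i - k2) * (k0 * k1 * k3 * q ^+ i - k2^-1)
       / (k0 * k1 * k3 * q ^+ i)) *: v i.-1
    + (k2 + k2^-1 - k0^-1 * k1^-1 * k3^-1 * q ^- i) *: v i
  else (k0^-1 * k1^-1 * k3^-1 * q ^- i.+1) *: (v i - v i.+1).
Proof.
case: (leqP i d) => hi; first by rewrite E_mx_basis_in.
rewrite E_mx_basis_out // (E_basis_out hi).
rewrite (@E_basis_out i.+1) 1?ltnW // subr0 !scaler0 addr0.
by case: ifP => // hoi; rewrite E_basis_out ?scaler0 //; apply: E_pred_out.
Qed.

Lemma E_T3 i : T 3%:R *m v i =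
  if odd i then
    - (k3^-1 * (k0 * k1 * k3 * q ^+ i - k2)
             * (k0 * k1 * k3 * q ^+ i - k2^-1)) *: v i.-1
    + k3^-1 *: v i + k3 *: v i.+1
  else k3 *: v i.
Proof.
case: (leqP i d) => hi.
  rewrite E_mx_basis_in //= /E_act /= /E_t3.
  by case: ifP => // _; case: eqP => // ->; rewrite (@E_basis_out d.+1) // scaler0.
rewrite E_mx_basis_out // (E_basis_out hi).
rewrite (@E_basis_out i.+1) 1?ltnW // !scaler0 !addr0.
by case: ifP => // hoi; rewrite E_basis_out ?scaler0 //; apply: E_pred_out.
Qed.

Lemma E_basis_ext (A B : 'M[F]_d.+1) :
  (forall i, A *m v i = B *m v i) -> A = B.
Proof.
move=> h; apply/matrixP => r s.
have hE (C : 'M[F]_d.+1) : (C *m v s) r 0 = C r s.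
  rewrite mxE (bigD1 s) //= mxE eqxx mulr1 big1 ?addr0 // => t /negPf ht.
  by rewrite mxE val_eqE ht mulr0.
by rewrite -hE h hE.
Qed.

Let k0n : k0 != 0 := E_k0_neq0 hk.
Let k1n : k1 != 0 := E_k1_neq0 hk.
Let k2n : k2 != 0 := E_k2_neq0 hk.
Let k3n : k3 != 0 := E_k3_neq0 hk.

Definition E_step :=
  (mulmxDr, mulmxBr, mulmxN, =^~ scalemxAr, E_T0, E_T1, E_T2, E_T3).

Lemma E_nat_case (P : nat -> Prop) :
  P 0%N -> P 1%N -> (forall n, odd n = false -> P n.+2) ->
  (forall n, odd n = true -> P n.+2) -> forall i, P i.
Proof. by move=> h0 h1 he ho [|[|i]] //; case hi: (odd i); [apply: ho|apply: he]. Qed.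

Ltac E_solve :=
  apply: E_basis_ext; elim/E_nat_case => [||n|n];
  rewrite -?mulmxA ?mulmxBl ?mul1mx -?scalemxAl;
  repeat (rewrite !E_step /=; try match goal with
    | |- odd _ = _ -> _ => let h := fresh "h" in move=> h; rewrite ?h /=
    | h : odd _ = _ |- _ => rewrite ?h /=
    end);
  rewrite ?mul1mx; apply/colP => r; rewrite !mxE /= ?expr0 ?exprS ?invr1; field;
  rewrite ?hq ?k0n ?k1n ?k2n ?k3n ?expf_neq0 ?hq.

Lemma E_quad0 : T 0 *m T 0 = (k0 + k0^-1) *: T 0 - 1%:M.
Proof. by E_solve. Qed.

Lemma E_quad1 : T 1 *m T 1 = (k1 + k1^-1) *: T 1 - 1%:M.
Proof. by E_solve. Qed.

Lemma E_quad2 : T 2%:R *m T 2%:R = (k2 + k2^-1) *: T 2%:R - 1%:M.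
Proof. by E_solve. Qed.

Lemma E_quad3 : T 3%:R *m T 3%:R = (k3 + k3^-1) *: T 3%:R - 1%:M.
Proof. by E_solve. Qed.

Lemma E_prod : T 0 *m (T 1 *m (T 2%:R *m T 3%:R)) = q^-1 *: 1%:M.
Proof. by E_solve. Qed.

Lemma E_par_neq0 j : E_par k0 k1 k2 k3 j != 0.
Proof. by case: j => -[|[|[|[|//]]]] /=. Qed.

Lemma E_quad j : let s := E_par k0 k1 k2 k3 j in
  T j *m T j = (s + s^-1) *: T j - 1%:M.
Proof.
case: j => -[|[|[|[|//]]]] h; rewrite /E_par /=;
  [have := E_quad0|have := E_quad1|have := E_quad2|have := E_quad3];
  by set i := (X in T X *m _); rewrite (_ : Ordinal h = i) //; apply: val_inj.
Qed.

Lemma E_relations : daha_relations q (E_gen q d k0 k1 k2 k3).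
Proof.
split=> [j|j|i j b|] /=; rewrite -?mulmxE.
- rewrite mulmxBr E_quad mul_mx_scalar; set X := _ *: _.
  by rewrite opprB addrC subrK.
- rewrite mulmxBl E_quad mul_scalar_mx; set X := _ *: _.
  by rewrite opprB addrC subrK.
- by rewrite addrC subrK scalar_mxC.
- by rewrite -!mulmxA E_prod.
Qed.

End ERelations.

(* [hd] and [hk] are used only to check the defining relations. *)
Definition E_module (F : fieldType) (q : F) (hq : q != 0) (d : nat)
    (hd : odd d) (k0 k1 k2 k3 : F) (hk : E_parameters q d k0 k1 k2 k3) : Type :=
  'cV[F]_d.+1.

Section EModule.
Variables (F : fieldType) (q : F) (hq : q != 0) (d : nat) (hd : odd d).
Variables (k0 k1 k2 k3 : F) (hk : E_parameters q d k0 k1 k2 k3).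
Local Notation H := (daha hq).
Local Notation E := (E_module hq hd hk).

HB.instance Definition _ := GRing.Zmodule.on E.

Definition E_rep : {lrmorphism H -> 'M[F]_d.+1} :=
  daha_lift (E_relations hq hd hk).

Definition E_scale (x : H) (w : E) : E := E_rep x *m (w : 'cV[F]_d.+1).

Lemma E_scaleA x y w : E_scale x (E_scale y w) = E_scale (x * y) w.
Proof. by rewrite /E_scale mulmxA rmorphM. Qed.

Lemma E_scale1 : left_id 1 E_scale.
Proof. by move=> w; rewrite /E_scale rmorph1 mul1mx. Qed.

Lemma E_scaleDr : right_distributive E_scale +%R.
Proof. by move=> x u w; rewrite /E_scale mulmxDr. Qed.

Lemma E_scaleDl w : {morph E_scale^~ w : x y / x + y}.
Proof. by move=> x y; rewrite /E_scale rmorphD mulmxDl. Qed.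

HB.instance Definition _ :=
  GRing.Zmodule_isLmodule.Build H E E_scaleA E_scale1 E_scaleDr E_scaleDl.

Lemma E_scale_basis (j : 'Z_4) (i : nat) : (i <= d)%N ->
  daha_gen hq j false *: (E_basis F d i : E) = E_act q d k0 k1 k2 k3 j i.
Proof.
move=> hi; rewrite -(E_mx_basis_in _ _ _ _ _ _ hi).
by rewrite -[LHS]/(daha_lift _ _ *m _) daha_lift_gen.
Qed.

End EModule.

(* Main.v *)
From HB Require Import structures.
Require Import Defs.
From mathcomp Require Import all_boot all_order all_algebra.
From mathcomp Require Import boolp ring zify.
Set Implicit Arguments.
Unset Strict Implicit.
Unset Printing Implicit Defensive.
Import GRing.Theory.
Local Open Scope ring_scope.

(** In dimension n = d + 1 = 2m the module V is generated by a common eigenvector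
of two cyclically adjacent generators, and determinants decide which two.

By Schur's lemma each central element t_j + t_j^-1 acts on V as a scalar
k_j + k_j^-1, so V amounts to four matrices T_j with
(T_j - k_j)(T_j - k_j^-1) = 0 ([irreducible_daha_mx]).  Each k_j may still be
exchanged with its inverse.

The quadratic relation ties the determinant of T_j to the rank of T_j - k_j:
the determinant is k_j^(n - 2 rank) ([det_quadratic]), hence it is 1 as soon as
both T_j - k_j and T_j - k_j^-1 have rank at least m.  The product of the four
determinants is q^-n, which is not 1 because q is not a root of unity; so some
determinant is not 1, and by rotating the indices this may be taken to be that
of T_0.  For a suitable choice of k_0 the eigenspace of T_0 at k_0 then has
dimension more than m, while for a suitable choice of k_3 the eigenspace of T_3
at k_3 has dimension at least m.  They meet: there is v <> 0 with
t_0 v = k_0 v and t_3 v = k_3 v.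

Such a v generates an infinite sequence x_0 = v, x_1, x_2, ... on which the
generators act by the formulas that define E(k_0, k_1, k_2, k_3), without the
truncation at d and without any condition on k_0 ([raising_T0], [raising_T1],
[raising_T2], [raising_T3]).  Each t_j x_i lies in the span of x_(i-1), x_i,
x_(i+1), so irreducibility makes x_0, ..., x_d a basis of V
([raising_free]).  Reading the leading terms off the formulas bounds the ranks
of the T_j - s from below, which gives det T_1 = det T_2 = 1 and
det T_0 = k_0^2 ([det_neq1_structure]).

The same argument started from T_3 shows that det T_3 <> 1 would force
det T_0 = 1.  So det T_3 = 1 as well, whence k_0^2 = q^-n.  At this value of
k_0 the vector x_n satisfies t_0 x_n = k_0^-1 x_n and t_3 x_n = k_3 x_n.  If it
were nonzero, the sequence raised from x_n would force the eigenspace of T_0 at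
k_0 to have dimension at most m, against its choice; so x_n = 0
([raising_terminates]).  The basis x_0, ..., x_d now obeys exactly the formulas
of E(k_0, k_1, k_2, k_3), and undoing the rotation gives the twist. *)

(** * Determinants, ranks and leading terms *)

Lemma det_sylvester (F : fieldType) m n (A : 'M[F]_(m, n)) (B : 'M[F]_(n, m)) :
  \det (1%:M + A *m B) = \det (1%:M + B *m A).
Proof.
pose U := block_mx 1%:M (- A) B 1%:M.
have e1 : \det U = \det (1%:M + A *m B).
  have -> : U = block_mx 1%:M (- A) 0 1%:M *m block_mx (1%:M + A *m B) 0 B 1%:M.
    rewrite mulmx_block !mul1mx !mulmx1 ?mul0mx ?mulmx0 ?add0r ?addr0 mulNmx.
    by rewrite addrK.
  by rewrite det_mulmx det_ublock det_lblock !det1 !mulr1 mul1r.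
rewrite -e1.
have -> : U = block_mx 1%:M 0 B 1%:M *m block_mx 1%:M (- A) 0 (1%:M + B *m A).
  rewrite mulmx_block !mul1mx !mulmx1 ?mul0mx ?mulmx0 ?add0r ?addr0 mulmxN.
  by rewrite addrC addrK.
by rewrite det_mulmx det_ublock det_lblock !det1 !mul1r.
Qed.

(** With N = A - k the quadratic relation reads N^2 = (k^-1 - k) N.  A full-rank
factorization N = C R therefore has R C = k^-1 - k, a scalar of size r, and
Sylvester's identity turns det (k + C R) into det (k + R C).  The equation has
no denominators, and no case distinction between k = k^-1, where A need not be
diagonalizable, and k <> k^-1. *)
Lemma det_quadratic (F : fieldType) n (A : 'M[F]_n) (k : F) (hk : k != 0)
    (hA : A *m A = (k + k^-1) *: A - 1%:M) (r := \rank (A - k%:M)) :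
  \det A * k ^+ (2 * r) = k ^+ n.
Proof.
rewrite {}/r; set N := A - k%:M; set r := \rank N.
have hN : N *m N = (k^-1 - k) *: N.
  rewrite /N mulmxBr !mulmxBl hA mul_mx_scalar mul_scalar_mx -scalar_mxM.
  apply/matrixP => i j; rewrite !mxE.
  by case: (i == j); rewrite ?mulr1n ?mulr0n; field.
have [C [R [hC hR hCR]]] : exists (C : 'M_(n, r)) (R : 'M_(r, n)),
    [/\ row_full C, row_free R & C *m R = N].
  exists (col_base N), (row_base N).
  by split; [exact: col_base_full|exact: row_base_free|exact: mulmx_base].
clearbody r.
have hRC : R *m C = (k^-1 - k)%:M.
  apply: (row_free_inj hR); apply: (row_full_inj hC).
  rewrite /= !mulmxA hCR -mulmxA hCR hN mul_mx_scalar -hCR.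
  by rewrite -scalemxAl.
have -> : A = k *: (1%:M + (k^-1 *: C) *m R).
  rewrite -scalemxAl hCR scalerDr scalerA divff // scale1r scalemx1.
  by rewrite /N addrC subrK.
rewrite detZ det_sylvester -scalemxAr hRC scale_scalar_mx -raddfD det_scalar.
rewrite -mulrA mul2n -addnn exprD -!exprMn.
have -> : (1 + k^-1 * (k^-1 - k)) * (k * k) = 1 by field.
by rewrite expr1n mulr1.
Qed.

Section Spans.
Variables (F : fieldType) (n : nat).
Implicit Types (x y : nat -> 'rV[F]_n).

Definition span_seq x s : 'M[F]_(s, n) := \matrix_(i < s) x i.

Lemma span_seq_in x s i : (i < s)%N -> (x i <= span_seq x s)%MS.
Proof. by move=> hi; rewrite -(rowK x (Ordinal hi)) row_sub. Qed.

Lemma span_seq_sub x s m (U : 'M[F]_(m, n)) :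
  (forall i, (i < s)%N -> (x i <= U)%MS) -> (span_seq x s <= U)%MS.
Proof. by move=> h; apply/row_subP => i; rewrite rowK h. Qed.

Lemma span_seqS x s t : (s <= t)%N -> (span_seq x s <= span_seq x t)%MS.
Proof.
by move=> h; apply: span_seq_sub => i hi; apply/span_seq_in/(leq_trans hi).
Qed.

Lemma rank_span_seq x s :
  (forall a, (a < s)%N -> ~~ (x a <= span_seq x a)%MS) ->
  \rank (span_seq x s) = s.
Proof.
elim: s => [|s IHs] h; first by apply/eqP; rewrite -leqn0 rank_leq_row.
apply/eqP; rewrite eqn_leq rank_leq_row -{1}(IHs _) => [|a ha]; last exact/h/ltnW.
apply: rank_ltmx; rewrite ltmxE span_seqS //=.
by apply: contra (h s (ltnSn s)); apply: submx_trans; apply: span_seq_in.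
Qed.

(** Triangularity: each z_a A has a nonzero multiple of x_(e a) as its leading
term, and the positions e a increase, so the z_a A are independent. *)
Lemma rank_leading x (A : 'M[F]_n) s (e : nat -> nat)
    (z : nat -> 'rV[F]_n) (c : nat -> F) :
    (forall a b, (a < b < s)%N -> (e a < e b)%N) ->
    (forall a, (a < s)%N -> ~~ (x (e a) <= span_seq x (e a))%MS) ->
    (forall a, (a < s)%N -> c a != 0) ->
    (forall a, (a < s)%N ->
      (z a *m A - c a *: x (e a) <= span_seq x (e a))%MS) ->
  (s <= \rank A)%N.
Proof.
move=> he hx hc hA; set y := fun a => z a *m A.
rewrite -{1}(@rank_span_seq y s).
  by apply/mxrankS/span_seq_sub => a ha; apply: submxMl.
move=> a ha; apply: contra (hx a ha) => hspan.
have hya : (y a <= span_seq x (e a))%MS.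
  apply: (submx_trans hspan); apply: span_seq_sub => b hb.
  have hlt : (e b < e a)%N by apply: he; rewrite hb.
  rewrite -(subrK (c b *: x (e b)) (y b)) addmx_sub //.
    exact/(submx_trans (hA _ (ltn_trans hb ha)))/span_seqS/ltnW.
  by rewrite scalemx_sub // span_seq_in.
have -> : x (e a) = (c a)^-1 *: (y a + (-1) *: (y a - c a *: x (e a))).
  by rewrite scaleN1r subKr scalerA mulVf ?hc // scale1r.
by rewrite scalemx_sub // addmx_sub // scalemx_sub // hA.
Qed.

(** At the least a for which x_a falls into the span of x_0, ..., x_(a-1), this
span would be a proper nonzero subspace invariant under all T_j, because T_j
raises indices by at most one. *)
Lemma span_invariant_free x (I : Type) (T : I -> 'M[F]_n) :
    x 0%N != 0 ->
    (forall U : 'M[F]_n, (forall j, (U *m T j <= U)%MS) -> U = 0 \/ row_full U) ->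
    (forall j i, (x i *m T j <= span_seq x i.+2)%MS) ->
  forall a, (a < n)%N -> ~~ (x a <= span_seq x a)%MS.
Proof.
move=> hx0 irr hT; elim/ltn_ind => a IHa ha; apply/negP => hxa.
have [j|h0|hfull] := irr <<span_seq x a>>%MS.
- rewrite (eqmxMr _ (genmxE _)) genmxE.
  apply/row_subP => i; rewrite row_mul rowK; apply: submx_trans (hT _ _) _.
  apply: span_seq_sub => l; rewrite ltnS => hl.
  have: (l <= a)%N by rewrite (leq_trans hl).
  by rewrite leq_eqVlt => /orP[/eqP->|] //; apply: span_seq_in.
- case: a hxa h0 {IHa} ha => [|a] hxa h0 ha.
    move: hxa; rewrite [span_seq x 0%N]flatmx0 => /submx0null/eqP.
    by rewrite (negPf hx0).
  have: (x 0%N <= (0 : 'M_n))%MS by rewrite -h0 genmxE span_seq_in.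
  by rewrite submx0 (negPf hx0).
- move: hfull; rewrite /row_full mxrank_gen rank_span_seq => [|b hb].
    by rewrite (ltn_eqF ha).
  exact/IHa/(ltn_trans hb ha).
Qed.

End Spans.

(** * Matrix form of the modules *)

(** The matrices act on row vectors, so that t_j v is written v *m T j; this
reverses the order of the factors in the relation t_0 t_1 t_2 t_3 = q^-1. *)
Record daha_mx (F : fieldType) (q : F) n (k : 'Z_4 -> F) (T : 'Z_4 -> 'M[F]_n) :
    Prop := DahaMx {
  dmx_neq0 : forall j, k j != 0;
  dmx_quad : forall j, T j *m T j = (k j + (k j)^-1) *: T j - 1%:M;
  dmx_prod : T 3%:R *m T 2%:R *m T 1 *m T 0 = q^-1%:M
}.

Section Inverses.
Variables (F : fieldType) (q : F) (hq : q != 0) (n : nat).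
Variables (k : 'Z_4 -> F) (T : 'Z_4 -> 'M[F]_n) (hT : daha_mx q k T).

Definition dmx_inv j : 'M[F]_n := (k j + (k j)^-1)%:M - T j.

Lemma dmx_mulV j : T j *m dmx_inv j = 1%:M.
Proof.
by rewrite mulmxBr (dmx_quad hT) mul_mx_scalar opprB addrC subrK.
Qed.

Lemma dmx_mulVl j : dmx_inv j *m T j = 1%:M.
Proof. exact/mulmx1C/dmx_mulV. Qed.

Lemma dmx_T2E : T 2%:R = q^-1 *: (dmx_inv 3%:R *m dmx_inv 0 *m dmx_inv 1).
Proof.
have h : dmx_inv 3%:R *m (T 3%:R *m T 2%:R *m T 1 *m T 0)
    *m dmx_inv 0 *m dmx_inv 1 = T 2%:R.
  rewrite !mulmxA dmx_mulVl mul1mx -(mulmxA _ (T 0)) dmx_mulV mulmx1.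
  by rewrite -mulmxA dmx_mulV mulmx1.
by rewrite -h (dmx_prod hT) mul_mx_scalar -!scalemxAl.
Qed.

Lemma dmx_T3VE : dmx_inv 3%:R = q *: (T 2%:R *m T 1 *m T 0).
Proof.
have h : dmx_inv 3%:R *m (T 3%:R *m T 2%:R *m T 1 *m T 0)
    = T 2%:R *m T 1 *m T 0.
  by rewrite !mulmxA dmx_mulVl mul1mx.
by rewrite -h (dmx_prod hT) mul_mx_scalar scalerA divff // scale1r.
Qed.

End Inverses.

(** * The raising sequence of a common eigenvector of T_0 and T_3 *)

Section RaisingStep.
Variables (F : fieldType) (q : F) (hq : q != 0) (n : nat).
Variables (k : 'Z_4 -> F) (T : 'Z_4 -> 'M[F]_n) (hT : daha_mx q k T).
Local Notation k0 := (k 0).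
Local Notation k1 := (k 1).
Local Notation k2 := (k 2%:R).
Local Notation k3 := (k 3%:R).
Let k0n : k0 != 0 := dmx_neq0 hT 0.
Let k1n : k1 != 0 := dmx_neq0 hT 1.
Let k2n : k2 != 0 := dmx_neq0 hT 2%:R.
Let k3n : k3 != 0 := dmx_neq0 hT 3%:R.

(* Q stands for q^i with i even, and p, c, x for the members of index i, i+1, i+2
   of the sequence.  The vector u is (1 - q^i)(1 - k_0^2 q^i) times the member of
   index i-1: carrying the vanishing factor inside u lets the step start at
   i = 0, where there is no such member. *)
Variables (Q : F) (hQ : Q != 0) (u p c x : 'rV[F]_n).
Hypothesis hp0 : p *m T 0 =
  (k0^-1 * Q^-1) *: u + (k0 + k0^-1 - k0^-1 * Q^-1) *: p.
Hypothesis hu0 : u *m T 0 =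
  (k0^-1 * Q^-1) *: (u - ((1 - Q) * (1 - k0 ^+ 2 * Q)) *: p).
Hypothesis hu1 : u *m T 1 = k1^-1 *: u.
Hypothesis hp3 : p *m T 3%:R = k3 *: p.
Hypothesis hc : c = k1 *: (p *m T 1) - k1 ^+ 2 *: p + k1 ^+ 2 *: u.
Hypothesis hx : x = c - (k0 * (q ^+ 2 * Q)) *: (c *m T 0).
Let K := k0 * k1 * k3 * (q * Q).
Let G := (K - k2) * (K - k2^-1).

Let quad j (w : 'rV_n) : w *m T j *m T j = (k j + (k j)^-1) *: (w *m T j) - w.
Proof.
by rewrite -mulmxA (dmx_quad hT) mulmxBr mulmx1 -scalemxAr.
Qed.

Let vecE := (mulmxDl, mulmxBl, mulNmx, =^~ scalemxAl, quad).

Ltac vec := apply/rowP => r; rewrite !mxE; field;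
  rewrite ?k0n ?k1n ?k2n ?k3n ?hq ?hQ.

Lemma step_T1_p : p *m T 1 = - k1 *: u + k1 *: p + k1^-1 *: c.
Proof. by rewrite hc; move: (p *m T 1) => w; vec. Qed.

Lemma step_T1_c : c *m T 1 = k1^-1 *: c.
Proof. by rewrite hc !vecE hu1; move: (p *m T 1) => w; vec. Qed.

(** Here the product relation is used as t_2 = q^-1 t_1^-1 t_0^-1 t_3^-1. *)
Lemma step_T2_p :
  p *m T 2%:R = (k0^-1 * k1^-1 * k3^-1 * (q^-1 * Q^-1)) *: (p - c).
Proof.
rewrite (dmx_T2E hT) -scalemxAr !mulmxA /dmx_inv.
rewrite !mulmxBr !mul_mx_scalar hp3 !vecE hp0 !vecE hu1 step_T1_p.
by vec.
Qed.

Let Kn : K != 0. Proof. by rewrite !mulf_neq0. Qed.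

(** Solving the formula for t_2 p for c makes t_2 c a combination of t_2 p and
t_2^2 p, which the quadratic relation reduces. *)
Lemma step_T2_c : c *m T 2%:R = (G / K) *: p + (k2 + k2^-1 - K^-1) *: c.
Proof.
have {1}-> : c = p - K *: (p *m T 2%:R) by rewrite step_T2_p /K; vec.
have -> : c = p - K *: (p *m T 2%:R) by rewrite step_T2_p /K; vec.
rewrite !vecE /G; move: (p *m T 2%:R) K Kn => w K' Kn'.
by vec; rewrite ?Kn'.
Qed.

Lemma step_T0_c : c *m T 0 = (k0^-1 * (q ^+ 2 * Q)^-1) *: (c - x).
Proof. by rewrite hx; move: (c *m T 0) => w; vec. Qed.

(** The product relation enters as t_3^-1 = q t_0 t_1 t_2, whose right-hand side
only involves actions that are already known on c, p and u. *)
Lemma step_T3_c : c *m T 3%:R = - (k3^-1 * G) *: p + k3^-1 *: c + k3 *: x.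
Proof.
have : c *m dmx_inv k T 3%:R = q *: (c *m T 2%:R *m T 1 *m T 0).
  by rewrite (dmx_T3VE hq hT) -scalemxAr !mulmxA.
rewrite step_T2_c !vecE step_T1_p step_T1_c !vecE hp0 hu0 step_T0_c.
rewrite mulmxBr mul_mx_scalar => h.
have -> : c *m T 3%:R = (k3 + k3^-1) *: c
    - ((k3 + k3^-1) *: c - c *m T 3%:R) by rewrite subKr.
by rewrite {}h /G /K; vec.
Qed.

Lemma step_T3_x : x *m T 3%:R = k3 *: x.
Proof.
have -> : x = k3^-1 *: (c *m T 3%:R + (k3^-1 * G) *: p - k3^-1 *: c).
  by rewrite step_T3_c; vec.
by rewrite !vecE hp3; move: (c *m T 3%:R) G => w G'; vec.
Qed.

Lemma step_T0_x (Q' := q ^+ 2 * Q) (b := (1 - Q') * (1 - k0 ^+ 2 * Q')) :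
  x *m T 0 = (k0^-1 * Q'^-1) *: (b *: c) + (k0 + k0^-1 - k0^-1 * Q'^-1) *: x.
Proof.
have Q'n : Q' != 0 by rewrite mulf_neq0 ?expf_neq0.
rewrite /b hx -/Q' !vecE; move: (c *m T 0) {b} Q' Q'n => w Q' Q'n.
by vec; rewrite ?Q'n.
Qed.

End RaisingStep.

Section RaisingSequence.
Variables (F : fieldType) (q : F) (hq : q != 0) (n : nat).
Variables (k : 'Z_4 -> F) (T : 'Z_4 -> 'M[F]_n) (hT : daha_mx q k T).
Local Notation k0 := (k 0).
Local Notation k1 := (k 1).
Local Notation k2 := (k 2%:R).
Local Notation k3 := (k 3%:R).
Variables (v : 'rV[F]_n).
Hypothesis hv0 : v *m T 0 = k0 *: v.
Hypothesis hv3 : v *m T 3%:R = k3 *: v.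

(** The recursion solves the formula for t_0 x_j (j odd) or t_1 x_j (j even) of
the module E for x_(j+1).  It needs the two preceding members; the member of
index -1 has coefficient 0, so its value 0 is only a default. *)
Fixpoint raising_pair (i : nat) : 'rV[F]_n * 'rV[F]_n :=
  if i is j.+1 then
    let: (u, w) := raising_pair j in
    (w, if odd j then w - (k0 * q ^+ j.+1) *: (w *m T 0)
        else k1 *: (w *m T 1) - k1 ^+ 2 *: w
             + (k1 ^+ 2 * (1 - q ^+ j) * (1 - k0 ^+ 2 * q ^+ j)) *: u)
  else (0, v).

Definition raising (i : nat) : 'rV[F]_n := (raising_pair i).2.
Local Notation x := raising.

Lemma raising_odd i : odd i ->
  x i.+1 = x i - (k0 * q ^+ i.+1) *: (x i *m T 0).
Proof. by move=> hi; rewrite /x /=; case: raising_pair => u w /=; rewrite hi. Qed.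

Lemma raising_even i : ~~ odd i ->
  x i.+1 = k1 *: (x i *m T 1) - k1 ^+ 2 *: x i
    + k1 ^+ 2 *: (((1 - q ^+ i) * (1 - k0 ^+ 2 * q ^+ i)) *: x i.-1).
Proof.
case: i => [_|i /negPf hi]; rewrite /x /=.
  by rewrite expr0 subrr mulr0 !mul0r !scale0r !scaler0.
by case: raising_pair => u w /=; move: hi => /= ->; rewrite scalerA mulrA.
Qed.

Let lowered i := ((1 - q ^+ i) * (1 - k0 ^+ 2 * q ^+ i)) *: x i.-1.

(* The invariant of the induction in steps of two: the hypotheses on u and p of
   the step above, at u = lowered i and p = x i. *)
Let ready i := [/\ x i *m T 0 = (k0^-1 * q ^- i) *: lowered i
                     + (k0 + k0^-1 - k0^-1 * q ^- i) *: x i,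
  lowered i *m T 0 = (k0^-1 * q ^- i) *:
     (lowered i - ((1 - q ^+ i) * (1 - k0 ^+ 2 * q ^+ i)) *: x i),
  lowered i *m T 1 = k1^-1 *: lowered i & x i *m T 3%:R = k3 *: x i].

Let raising_ready a : ready a.*2.
Proof.
elim: a => [|a [h0 l0 l1 h3]].
  have l : lowered 0 = 0 by rewrite /lowered expr0 subrr mul0r scale0r.
  split; rewrite ?l ?mul0mx ?scaler0 ?hv3 // ?add0r expr0 ?invr1 ?mulr1 ?addrK //.
  by rewrite subrr mul0r scale0r oppr0 scaler0.
set i := a.*2 in h0 l0 l1 h3 *.
have hi : ~~ odd i by rewrite odd_double.
have Qn : q ^+ i != 0 by rewrite expf_neq0.
have hc := raising_even hi; rewrite -/(lowered i) in hc.
have hx : x i.+2 = x i.+1 - (k0 * (q ^+ 2 * q ^+ i)) *: (x i.+1 *m T 0).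
  by rewrite raising_odd /= ?hi // -exprD.
have e : q ^+ i.+2 = q ^+ 2 * q ^+ i by rewrite -exprD.
have c0 := step_T0_c hq hT Qn hx; rewrite -e in c0.
split; rewrite -?doubleS ?doubleS -/i /lowered /= ?e.
- exact: (step_T0_x hq hT Qn hx).
- rewrite -scalemxAl c0 -e; apply/rowP => r; rewrite !mxE; field.
  by rewrite expf_neq0 // (dmx_neq0 hT).
- rewrite -scalemxAl (step_T1_c hT l1 hc).
  by rewrite !scalerA; congr (_ *: _); apply: mulrC.
exact: (step_T3_x hq hT Qn h0 l0 l1 h3 hc hx).
Qed.

Lemma raising_T0 i : x i *m T 0 =
  if odd i then (k0^-1 * q ^- i.+1) *: (x i - x i.+1)
  else (k0^-1 * q ^- i * (1 - q ^+ i) * (1 - k0 ^+ 2 * q ^+ i)) *: x i.-1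
       + (k0 + k0^-1 - k0^-1 * q ^- i) *: x i.
Proof.
case: ifP => [|/negbT] hi.
  rewrite (raising_odd hi) subKr scalerA; set c := (X in X *: _).
  suff -> : c = 1 by rewrite scale1r.
  by rewrite /c; field; rewrite expf_neq0 // (dmx_neq0 hT).
have [h0 _ _ _] := raising_ready i./2; rewrite even_halfK // in h0.
by rewrite h0 /lowered scalerA !mulrA.
Qed.

Lemma raising_T1 i : x i *m T 1 =
  if odd i then k1^-1 *: x i
  else - (k1 * (1 - q ^+ i) * (1 - k0 ^+ 2 * q ^+ i)) *: x i.-1
       + k1 *: x i + k1^-1 *: x i.+1.
Proof.
case: ifP => [hi|/negbT hi].
  case: i hi => // i /= hi; have [_ _ l1 _] := raising_ready i./2.
  rewrite even_halfK // in l1; exact: (step_T1_c hT l1 (raising_even hi)).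
rewrite (step_T1_p hT (raising_even hi)) scalerA.
by rewrite mulNr mulrA.
Qed.

Lemma raising_T2 i : x i *m T 2%:R =
  if odd i then
    ((k0 * k1 * k3 * q ^+ i - k2) * (k0 * k1 * k3 * q ^+ i - k2^-1)
       / (k0 * k1 * k3 * q ^+ i)) *: x i.-1
    + (k2 + k2^-1 - k0^-1 * k1^-1 * k3^-1 * q ^- i) *: x i
  else (k0^-1 * k1^-1 * k3^-1 * q ^- i.+1) *: (x i - x i.+1).
Proof.
case: ifP => [hi|/negbT hi].
  case: i hi => // i /= hi; have [h0 _ l1 h3] := raising_ready i./2.
  rewrite even_halfK // in h0 l1 h3.
  rewrite (step_T2_c hq hT (expf_neq0 _ hq) h0 l1 h3 (raising_even hi)) -exprS.
  by rewrite !invfM.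
have [h0 _ l1 h3] := raising_ready i./2; rewrite even_halfK // in h0 l1 h3.
rewrite (step_T2_p hq hT (expf_neq0 _ hq) h0 l1 h3 (raising_even hi)).
by rewrite [q ^+ i.+1]exprS invfM.
Qed.

Lemma raising_T3 i : x i *m T 3%:R =
  if odd i then
    - (k3^-1 * (k0 * k1 * k3 * q ^+ i - k2)
             * (k0 * k1 * k3 * q ^+ i - k2^-1)) *: x i.-1
    + k3^-1 *: x i + k3 *: x i.+1
  else k3 *: x i.
Proof.
case: ifP => [hi|/negbT hi].
  case: i hi => // i /= hi; have [h0 l0 l1 h3] := raising_ready i./2.
  rewrite even_halfK // in h0 l0 l1 h3.
  have hx : x i.+2 = x i.+1 - (k0 * (q ^+ 2 * q ^+ i)) *: (x i.+1 *m T 0).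
    by rewrite raising_odd /= ?hi // -exprD.
  rewrite (step_T3_c hq hT (expf_neq0 _ hq) h0 l0 l1 h3 (raising_even hi) hx).
  by rewrite -exprS mulrA.
by have [_ _ _ h3] := raising_ready i./2; rewrite even_halfK // in h3.
Qed.

End RaisingSequence.

Lemma Z4_case (P : 'Z_4 -> Prop) :
  P 0 -> P 1 -> P 2%:R -> P 3%:R -> forall j, P j.
Proof.
move=> h0 h1 h2 h3 [[|[|[|[|//]]]] h]; [move: h0|move: h1|move: h2|move: h3];
  by congr (P _); apply: val_inj.
Qed.

(** Only the T_j are mentioned: T_j^-1 is a polynomial in T_j, so it preserves
the same subspaces. *)
Definition mx_irreducible (F : fieldType) n (T : 'Z_4 -> 'M[F]_n) : Prop :=
  forall U : 'M[F]_n, (forall j, (U *m T j <= U)%MS) -> U = 0 \/ row_full U.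

(** * Ranks of T_j - s *)

Section Quadratic.
Variables (F : fieldType) (m : nat).
Local Notation n := m.*2.
Variables (A : 'M[F]_n) (k : F) (hk : k != 0).
Hypothesis hA : A *m A = (k + k^-1) *: A - 1%:M.

Lemma quadratic_rank : (\rank (A - k%:M)%R + \rank (A - k^-1%:M)%R <= n)%N.
Proof.
suff h : (A - k%:M) *m (A - k^-1%:M) = 0.
  by have := @mxrank_mul_min _ _ _ _ (A - k%:M) (A - k^-1%:M); rewrite h mxrank0; lia.
rewrite mulmxBr !mulmxBl hA !mul_mx_scalar mul_scalar_mx.
rewrite scale_scalar_mx mulVf //; apply/matrixP => i j; rewrite !mxE.
by case: (i == j); rewrite ?mulr1n ?mulr0n; ring.
Qed.

Lemma quadratic_det1 : (m <= \rank (A - k%:M)%R)%N ->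
  (m <= \rank (A - k^-1%:M)%R)%N -> \det A = 1.
Proof.
move=> h1 h2; have h := quadratic_rank.
have e : \rank (A - k%:M)%R = m by lia.
have := det_quadratic hk hA; rewrite /= e mul2n -[RHS]mul1r.
by apply: mulIf; rewrite expf_neq0.
Qed.

Lemma quadratic_half_rank :
  exists2 s, s = k \/ s = k^-1 & (\rank (A - s%:M)%R <= m)%N.
Proof.
have h := quadratic_rank; case: (leqP (\rank (A - k%:M)%R) m) => hm.
  by exists k; [left|].
exists k^-1; first by right.
by rewrite -(leq_add2l m) addnn (leq_trans _ h) // leq_add2r ltnW.
Qed.

(** Since T - k and T - k^-1 annihilate each other their ranks add up to at most
2m; if neither is below m, both equal m and the determinant is 1. *)
Lemma quadratic_low_rank : \det A != 1 ->
  exists2 s, s = k \/ s = k^-1 & (\rank (A - s%:M)%R < m)%N.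
Proof.
move=> hdet; case: (ltnP (\rank (A - k%:M)%R) m) => h1.
  by exists k; [left|].
case: (ltnP (\rank (A - k^-1%:M)%R) m) => h2; first by exists k^-1; [right|].
by rewrite quadratic_det1 ?eqxx in hdet.
Qed.

End Quadratic.

Lemma rank_shared_eigenvector (F : fieldType) n (A B : 'M[F]_n) (a b : F) :
  (\rank (A - a%:M)%R + \rank (B - b%:M)%R < n)%N ->
  exists v : 'rV_n, [/\ v != 0, v *m A = a *: v & v *m B = b *: v].
Proof.
set rA := \rank _; set rB := \rank _ => h.
set U := (eigenspace A a :&: eigenspace B b)%MS.
have hU : U != 0.
  have := mxrank_sum_cap (eigenspace A a) (eigenspace B b).
  have := rank_leq_col (eigenspace A a + eigenspace B b)%MS.
  have eA : \rank (eigenspace A a) = (n - rA)%N by exact: mxrank_ker.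
  have eB : \rank (eigenspace B b) = (n - rB)%N by exact: mxrank_ker.
  rewrite -mxrank_eq0 -lt0n -/U eA eB; lia.
exists (nz_row U); split; first by rewrite nz_row_eq0.
  by apply/eigenspaceP/(submx_trans (nz_row_sub U))/capmxSl.
by apply/eigenspaceP/(submx_trans (nz_row_sub U))/capmxSr.
Qed.

Section RaisingRank.
Variables (F : fieldType) (q : F) (hq : q != 0) (m : nat).
Local Notation n := m.*2.
Variables (k : 'Z_4 -> F) (T : 'Z_4 -> 'M[F]_n) (hT : daha_mx q k T).
Hypothesis irr : mx_irreducible T.
Variables (v : 'rV[F]_n) (hv : v != 0).
Hypothesis hv0 : v *m T 0 = k 0 *: v.
Hypothesis hv3 : v *m T 3%:R = k 3%:R *: v.
Local Notation x := (raising q k T v).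

Let xT0 := raising_T0 hq hT hv0 hv3.
Let xT1 := raising_T1 hq hT hv0 hv3.
Let xT2 := raising_T2 hq hT hv0 hv3.
Let xT3 := raising_T3 hq hT hv0 hv3.

Let xin i s : (i < s)%N -> (x i <= span_seq x s)%MS.
Proof. exact: span_seq_in. Qed.

Ltac in_span := rewrite ?(addmx_sub, scalemx_sub, eqmx_opp, xin) //; try lia.

Lemma raising_free a : (a < n)%N -> ~~ (x a <= span_seq x a)%MS.
Proof.
apply: (span_invariant_free (T := T)) => // j i.
elim/Z4_case: j; rewrite ?xT0 ?xT1 ?xT2 ?xT3; case: ifP => _; in_span.
Qed.

(** In each pair (x_2a, x_(2a+1)) the image of x_2a under t_1 has a component
along x_(2a+1), whatever multiple s of the identity is subtracted.  The same
pairs serve for t_2, and the pairs (x_(2a+1), x_(2a+2)) for t_0; the latter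
leave out x_0, so they are one fewer. *)
Lemma raising_rank_T1 s : (m <= \rank (T 1 - s%:M)%R)%N.
Proof.
apply: (rank_leading (x := x) (e := fun a => a.*2.+1)
          (z := fun a => x a.*2) (c := fun=> (k 1)^-1)) => [a b|a|a|a] h.
- lia.
- apply: raising_free; lia.
- by rewrite invr_eq0 (dmx_neq0 hT).
rewrite mulmxBr mul_mx_scalar xT1 odd_double addrAC addrK.
in_span.
Qed.

Lemma raising_rank_T2 s : (m <= \rank (T 2%:R - s%:M)%R)%N.
Proof.
apply: (rank_leading (x := x) (e := fun a => a.*2.+1) (z := fun a => x a.*2)
  (c := fun a => - ((k 0)^-1 * (k 1)^-1 * (k 3%:R)^-1 * q ^- a.*2.+1)))
   => [a b|a|a|a] h.
- lia.
- apply: raising_free; lia.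
- by rewrite oppr_eq0 !mulf_neq0 ?invr_eq0 ?expf_neq0 ?(dmx_neq0 hT).
rewrite mulmxBr mul_mx_scalar xT2 odd_double scalerBr scaleNr opprK
  addrAC subrK.
in_span.
Qed.

Lemma raising_rank_T0 s : (m.-1 <= \rank (T 0 - s%:M)%R)%N.
Proof.
apply: (rank_leading (x := x) (e := fun a => a.*2.+2) (z := fun a => x a.*2.+1)
  (c := fun a => - ((k 0)^-1 * q ^- a.*2.+2))) => [a b|a|a|a] h.
- lia.
- apply: raising_free; lia.
- by rewrite oppr_eq0 !mulf_neq0 ?invr_eq0 ?expf_neq0 ?(dmx_neq0 hT).
rewrite mulmxBr mul_mx_scalar xT0 /= odd_double /= scalerBr scaleNr opprK
  addrAC subrK.
in_span.
Qed.

(** For s <> k_0 the eigenvector x_0 itself contributes one more dimension to the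
image of t_0 - s. *)
Lemma raising_rank_T0_other s : s != k 0 -> (m <= \rank (T 0 - s%:M)%R)%N.
Proof.
move=> hs.
apply: (rank_leading (x := x) (e := fun a => a.*2) (z := fun a => x a.*2.-1)
  (c := fun a => if a == 0%N then k 0 - s else - ((k 0)^-1 * q ^- a.*2)))
  => [a b|a|a|[|a]] h.
- lia.
- apply: raising_free; lia.
- case: ifP => _; first by rewrite subr_eq0 eq_sym.
  by rewrite oppr_eq0 !mulf_neq0 ?invr_eq0 ?expf_neq0 ?(dmx_neq0 hT).
- by rewrite /= mulmxBr mul_mx_scalar hv0 scalerBl subrr sub0mx.
rewrite mulmxBr mul_mx_scalar xT0 /= odd_double /= scalerBr scaleNr opprK
  addrAC subrK.
in_span.
Qed.

End RaisingRank.

(** * Determinants select the twist *)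

Lemma daha_mx_choice (F : fieldType) (q : F) n (k k' : 'Z_4 -> F)
    (T : 'Z_4 -> 'M[F]_n) :
  daha_mx q k T -> (forall j, k' j = k j \/ k' j = (k j)^-1) ->
  daha_mx q k' T.
Proof.
case=> kn quad prod hk; split=> // j.
  by case: (hk j) => ->; rewrite ?invr_eq0.
by rewrite quad; case: (hk j) => ->; rewrite ?invrK // [k j + _]addrC.
Qed.

Section Rotate.
Variables (F : fieldType) (q : F) (n : nat).
Implicit Types (k : 'Z_4 -> F) (T : 'Z_4 -> 'M[F]_n).

Lemma daha_mx_rot1 k T : daha_mx q k T ->
  daha_mx q (fun j => k (j + 1)) (fun j => T (j + 1)).
Proof.
move=> hT; split=> [j|j|]; [exact: (dmx_neq0 hT)|exact: (dmx_quad hT)|].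
have h := dmx_prod hT.
have -> : T (3%:R + 1) *m T (2%:R + 1) *m T (1 + 1) *m T (0 + 1)
    = T 0 *m T 3%:R *m T 2%:R *m T 1.
  by congr (_ *m _ *m _ *m _); congr T; apply: val_inj.
rewrite -!mulmxA [_ *m (_ *m T 1)]mulmxA; set P := _ *m T 1 in h *.
rewrite -[LHS]mulmx1 -(dmx_mulV hT 0) -mulmxA (mulmxA P) h.
by rewrite mul_scalar_mx -scalemxAr (dmx_mulV hT) scalemx1.
Qed.

Lemma daha_mx_rot k T e : daha_mx q k T ->
  daha_mx q (fun j => k (j + e)) (fun j => T (j + e)).
Proof.
rewrite -[e]natr_Zp; elim: (val e) => [|i IHi] hT.
  rewrite (_ : (fun j => k _) = k) 1?(_ : (fun j => T _) = T) //;
    by apply/funext => j; rewrite addr0.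
rewrite (_ : (fun j => k _) = fun j => k (j + 1 + i%:R)); last first.
  by apply/funext => j; rewrite -addrA mulrS.
rewrite (_ : (fun j => T _) = fun j => T (j + 1 + i%:R)); last first.
  by apply/funext => j; rewrite -addrA mulrS.
exact: (daha_mx_rot1 (IHi hT)).
Qed.

Lemma mx_irreducible_rot T e : mx_irreducible T ->
  mx_irreducible (fun j => T (j + e)).
Proof.
by move=> irr U hU; apply: irr => j; have := hU (j - e); rewrite subrK.
Qed.

Lemma daha_mx_det k T : daha_mx q k T ->
  \det (T 3%:R) * \det (T 2%:R) * \det (T 1) * \det (T 0) = q^-1 ^+ n.
Proof. by move=> hT; rewrite -!det_mulmx (dmx_prod hT) det_scalar. Qed.

End Rotate.

Section Main.
Variables (F : fieldType) (q : F) (hq : q != 0) (m : nat).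
Local Notation n := m.*2.
Implicit Types (k : 'Z_4 -> F) (T : 'Z_4 -> 'M[F]_n).

(** The eigenspace of T_0 at k'_0 has dimension at least m + 1 and that of T_3
at k'_3 at least m, so they share a vector v in dimension 2m.  Its raising
sequence bounds the rank of T_0 - k'_0 below by m - 1, and the ranks that govern
det T_1 and det T_2 below by m. *)
Lemma det_neq1_structure k T :
  daha_mx q k T -> mx_irreducible T -> \det (T 0) != 1 ->
  exists (k' : 'Z_4 -> F) (v : 'rV[F]_n),
    [/\ daha_mx q k' T,
        [/\ v != 0, v *m T 0 = k' 0 *: v & v *m T 3%:R = k' 3%:R *: v],
        (\rank (T 0 - (k' 0)%:M)%R < m)%N,
        k' 0 ^+ 2 = \det (T 0) &
        \det (T 1) = 1 /\ \det (T 2%:R) = 1].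
Proof.
move=> hT irr hdet.
have [s0 hs0 r0] := quadratic_low_rank (dmx_neq0 hT 0) (dmx_quad hT 0) hdet.
have [s3 hs3 r3] := quadratic_half_rank (k := k 3%:R) (dmx_neq0 hT _) (dmx_quad hT _).
pose k' (j : 'Z_4) := if j == 0 then s0 else if j == 3%:R then s3 else k j.
have hT' : daha_mx q k' T.
  apply: (daha_mx_choice hT) => j; rewrite /k'.
  by case: eqP => [->|_] //; case: eqP => [->|_] //; left.
have [v [v0 hv0 hv3]] : exists v : 'rV_n,
    [/\ v != 0, v *m T 0 = k' 0 *: v & v *m T 3%:R = k' 3%:R *: v].
  apply: rank_shared_eigenvector; rewrite -[X in (_ < X)%N]addnn.
  by rewrite -addSn; apply: leq_add.
exists k', v; split=> //.
  have r0' := raising_rank_T0 hq hT' irr v0 hv0 hv3 s0.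
  have := det_quadratic (dmx_neq0 hT' 0) (dmx_quad hT' 0).
  rewrite [k' 0]/= /= -[k' 0]/s0.
  have -> : \rank (T 0 - s0%:M) = m.-1 by apply/eqP;
    rewrite eqn_leq r0' andbT; lia.
  have s0n : s0 != 0 by apply: (dmx_neq0 hT' 0).
  have -> : s0 ^+ n = s0 ^+ 2 * s0 ^+ (2 * m.-1)
    by rewrite -exprD; congr (_ ^+ _); lia.
  by move=> /mulIf ->; rewrite ?expf_neq0.
by split; [apply: (quadratic_det1 (dmx_neq0 hT' 1) (dmx_quad hT' 1))
          |apply: (quadratic_det1 (dmx_neq0 hT' 2%:R) (dmx_quad hT' 2%:R))];
  rewrite ?(raising_rank_T1 hq hT' irr v0 hv0 hv3) //;
  rewrite ?(raising_rank_T2 hq hT' irr v0 hv0 hv3).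
Qed.

(** The member x_n is an eigenvector of T_0 at k_0^-1 and of T_3 at k_3.  Were it
nonzero, its own raising sequence, formed with k_0^-1 in place of k_0, would
give T_0 - k_0 rank at least m. *)
Lemma raising_terminates k T (v : 'rV[F]_n) :
  daha_mx q k T -> mx_irreducible T ->
  v *m T 0 = k 0 *: v -> v *m T 3%:R = k 3%:R *: v ->
  (\rank (T 0 - (k 0)%:M)%R < m)%N ->
  k 0 ^+ 2 = q ^- n -> q ^- n != 1 ->
  raising q k T v n = 0.
Proof.
move=> hT irr hv0 hv3 hr hk hqn; apply/eqP; apply: contraT => hx.
have k0n := dmx_neq0 hT 0.
pose k' (j : 'Z_4) := if j == 0 then (k 0)^-1 else k j.
have hT' : daha_mx q k' T.
  apply: (daha_mx_choice hT) => j; rewrite /k'.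
  by case: eqP => [->|_]; [right|left].
have h0 := raising_T0 hq hT hv0 hv3 n; have h3 := raising_T3 hq hT hv0 hv3 n.
rewrite odd_double hk mulVf ?expf_neq0 // subrr mulr0 scale0r add0r in h0.
rewrite odd_double in h3.
have hw0 : raising q k T v n *m T 0 = k' 0 *: raising q k T v n.
  rewrite h0; congr (_ *: _); rewrite -[k' 0]/(k 0)^-1 -hk; field.
  exact: k0n.
have := raising_rank_T0_other hq hT' irr hx hw0 h3 (s := k 0).
rewrite leqNgt hr; apply; rewrite -[k' 0]/(k 0)^-1.
apply: contra hqn => /eqP h; rewrite -hk expr2 {1}h mulVf //.
Qed.

(** If both det T_0 and det T_3 differed from 1, [det_neq1_structure] for the
tuple that starts at T_3 would make det T_0 = 1, as T_0 comes next after T_3 in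
cyclic order.  So exactly one determinant differs from 1, and it is q^-n. *)
Theorem daha_mx_classification k T :
  daha_mx q k T -> mx_irreducible T -> q ^- n != 1 ->
  exists (e : 'Z_4) (k' : 'Z_4 -> F) (v : 'rV[F]_n),
    let T' := fun j => T (j + e) in
    [/\ daha_mx q k' T', v != 0,
        v *m T' 0 = k' 0 *: v /\ v *m T' 3%:R = k' 3%:R *: v,
        k' 0 ^+ 2 = q ^- n & raising q k' T' v n = 0].
Proof.
move=> hT irr hqn.
(* The rotation by e brings a generator of determinant different from 1 to index 0. *)
have [e he] : exists e, \det (T e) != 1.
  apply: contrapT => /forallNP hdet; case/negP: hqn.
  have hd j : \det (T j) = 1 by apply/eqP/negPn/negP/hdet.
  by have := daha_mx_det hT; rewrite !hd !mulr1 exprVn => <-.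
pose T' j := T (j + e).
have hT' := daha_mx_rot e hT; have irr' := mx_irreducible_rot (e := e) irr.
have [|k' [v [hk [v0 hv0 hv3] hr hdet0 [hdet1 hdet2]]]] :=
  det_neq1_structure hT' irr'; first by rewrite add0r.
have hdet3 : \det (T' 3%:R) = 1.
  apply/eqP; apply: contraT => hd3.
  have [|_ [_ [_ _ _ _ [hd _]]]] :=
    det_neq1_structure (daha_mx_rot 3%:R hT') (mx_irreducible_rot (e := 3%:R) irr').
    by rewrite add0r.
  move: he; rewrite -hd /T' (_ : 1 + 3%:R + e = e) ?eqxx //.
  by rewrite (_ : 1 + 3%:R = 0) ?add0r //; apply: val_inj.
have hk0 : k' 0 ^+ 2 = q ^- n.
  rewrite hdet0 -exprVn -(daha_mx_det hT') hdet1 hdet2.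
  by rewrite -[T (3%:R + e)]/(T' 3%:R) hdet3 !mul1r.
exists e, k', v; split=> //.
exact: raising_terminates.
Qed.

End Main.

(** * From modules to matrices *)

Lemma mulr_algC (F : fieldType) (A : algType F) (a : F) (x : A) :
  x * a%:A = a%:A * x.
Proof. by rewrite mulr_algl mulr_algr. Qed.

Section Bridge.
Variables (F : fieldType) (q : F) (hq : q != 0).
Local Notation H := (daha hq).
Local Notation t := (daha_gen hq).

Lemma daha_generated (P : H -> Prop) :
  (forall a, P (a%:A)) -> (forall i b, P (t i b)) ->
  (forall x y, P x -> P y -> P (x + y)) ->
  (forall x y, P x -> P y -> P (x * y)) -> forall x, P x.
Proof.
move=> hc hg hD hM; elim/daha_ind; elim=> [a|i b|x hx y hy|x hx y hy].
- by have := hc a; rewrite daha_algE.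
- exact: hg.
- by rewrite daha_piD; apply: hD.
- by rewrite daha_piM; apply: hM.
Qed.

(** It suffices to test the t_i: compatibility with an invertible element gives
compatibility with its inverse. *)
Lemma daha_linear_gen (V W : lmodType H) (g : V -> W) :
  {morph g : u v / u + v} -> (forall a v, g (a%:A *: v) = a%:A *: g v) ->
  (forall i v, g (t i false *: v) = t i false *: g v) -> linear g.
Proof.
move=> hD hA hg; have [hr hl _ _] := daha_gen_relations hq.
suff h x v : g (x *: v) = x *: g v by move=> x u v; rewrite hD h.
elim/daha_generated: x v => [a|i b|x y hx hy|x y hx hy] v.
- exact: hA.
- case: b; last exact: hg.
  by rewrite -[LHS]scale1r -(hl i) -scalerA -hg scalerA hr scale1r.
- by rewrite !scalerDl hD hx hy.
- by rewrite -!scalerA hx hy.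
Qed.

Lemma daha_submod_closed (V : lmodType H) (W : {pred V}) :
  0 \in W -> {in W &, forall u v, u + v \in W} ->
  (forall a, {in W, forall v, a%:A *: v \in W}) ->
  (forall i b, {in W, forall v, t i b *: v \in W}) -> submod_closed W.
Proof.
move=> h0 hD hA hg; split=> // x u v hu hv.
apply: (hD) => //; elim/daha_generated: x u hu => [a|i b|x y hx hy|x y hx hy] u hu.
- exact: hA.
- exact: hg.
- by rewrite scalerDl hD ?hx ?hy.
- by rewrite -scalerA hx ?hy.
Qed.

Lemma linear_underlyingD (n : nat) (V : lmodType H)
    (f : {linear underlying V -> 'rV[F]_n}) (u v : V) : f (u + v) = f u + f v.
Proof. exact: (linearD f). Qed.

Lemma linear_underlyingZ (n : nat) (V : lmodType H)
    (f : {linear underlying V -> 'rV[F]_n}) (a : F) (v : V) :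
  f ((a%:A : H) *: v) = a *: f v.
Proof. exact: (linearZZ f a v). Qed.

Lemma daha_action_mx (n : nat) (V : lmodType H)
    (f : {linear underlying V -> 'rV[F]_n}) (x : H) : bijective f ->
  exists A : 'M[F]_n, forall v : V, f (x *: v) = f v *m A.
Proof.
case=> g fK gK.
pose h (r : 'rV[F]_n) : 'rV[F]_n := f (x *: (g r : V)).
have hlin : linear h.
  move=> a u v; have -> : h (a *: u + v) = f (x *: ((a%:A : H) *: (g u : V) + g v)).
    congr (f (x *: _)); apply: (can_inj fK); rewrite gK.
    by rewrite [RHS](linearP f) !gK.
  by rewrite scalerDr scalerA mulr_algC -scalerA [LHS](linearP f).
pose hl : {linear 'rV[F]_n -> 'rV[F]_n} :=
  HB.pack h (GRing.isLinear.Build F _ _ _ h hlin).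
by exists (lin1_mx hl) => v; rewrite mul_rV_lin1 -[RHS]/(h (f v)) /h fK.
Qed.

End Bridge.

Section Schur.
Variables (F : closedFieldType) (q : F) (hq : q != 0).
Local Notation H := (daha hq).
Local Notation t := (daha_gen hq).
Variables (n : nat) (V : lmodType H) (hirr : irreducible_module V).
Variables (f : {linear underlying V -> 'rV[F]_n.+1}) (fbij : bijective f).

(** Schur's lemma: an eigenspace of a central element is a submodule. *)
Lemma central_scalar (z : H) : (forall i b, z * t i b = t i b * z) ->
  exists a : F, forall v : V, z *: v = (a%:A : H) *: v.
Proof.
move=> hz; have [A hA] := daha_action_mx z fbij.
have [a ha] : exists a, eigenvalue A a.
  have : size (char_poly A) != 1%N by rewrite size_char_poly.
  by case/closed_rootP => a ha; exists a; rewrite eigenvalue_root_char.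
exists a; have [w hw wn0] := eigenvalueP ha.
have [g fK gK] := fbij.
pose W := [pred v : V | z *: v == (a%:A : H) *: v].
have hsub : submod_closed W.
  apply: daha_submod_closed => [|u v|b u|i b u]; rewrite ?inE.
  - by rewrite !scaler0.
  - by move=> /eqP hu /eqP hv; rewrite !scalerDr hu hv.
  - move=> /eqP hu; apply/eqP.
    by rewrite [LHS]scalerA mulr_algC -[LHS]scalerA hu !scalerA mulr_algC.
  - by move=> /eqP hu; rewrite scalerA hz -scalerA hu !scalerA mulr_algC.
have [_ /(_ W hsub)[hW|hW v]] := hirr; last exact/eqP/hW.
have : g w = 0.
  apply: hW; rewrite inE; apply/eqP; apply: (can_inj fK).
  by rewrite hA gK hw [RHS]linear_underlyingZ gK.
by move/(congr1 f); rewrite gK [RHS]linear0 => /eqP; rewrite (negPf wn0).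
Qed.

Lemma irreducible_daha_mx : exists (k : 'Z_4 -> F) (T : 'Z_4 -> 'M[F]_n.+1),
  [/\ daha_mx q k T, mx_irreducible T &
      forall j (v : V), f (t j false *: v) = f v *m T j].
Proof.
have [hr hl hc hp] := daha_gen_relations hq; have [g fK gK] := fbij.
have /choice[T hT] : forall j, exists A : 'M[F]_n.+1,
    forall v : V, f (t j false *: v) = f v *m A.
  by move=> j; apply: daha_action_mx.
have /choice[k hk] : forall j, exists s : F, s != 0 /\
    forall v : V, (t j false + t j true) *: v = ((s + s^-1)%:A : H) *: v.
  move=> j; have [i b|a ha] := @central_scalar (t j false + t j true).
    exact: hc.
  (* A root s of X^2 - a X + 1 is nonzero and satisfies s + s^-1 = a. *)
  have : size (Poly [:: 1; - a; 1]) != 1%N by rewrite (@PolyK _ 0) //= oner_neq0.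
  case/closed_rootP => s; rewrite /root horner_Poly /= mul0r add0r mul1r => /eqP hs.
  have sn : s != 0.
    by apply: contra_eq_neq hs => ->; rewrite mulr0 add0r oner_neq0.
  exists s; split=> // v; rewrite ha; congr (_%:A *: _).
  have -> : a = s + s^-1 - s^-1 * ((s - a) * s + 1) by field.
  by rewrite hs mulr0 subr0.
have hmx (A B : 'M[F]_n.+1) : (forall v : V, f v *m A = f v *m B) -> A = B.
  move=> h; apply/row_matrixP => i; rewrite !rowE.
  by rewrite -[delta_mx _ _]gK.
exists k, T; split=> //; first split.
- by move=> j; have [] := hk j.
- move=> j; apply: hmx => v; have [_ /(_ (t j false *: v))] := hk j.
  rewrite scalerDl [t j true *: _]scalerA hl scale1r => /(congr1 f).
  rewrite [LHS]linear_underlyingD [RHS]linear_underlyingZ !hT => h.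
  by rewrite mulmxBr mulmx1 -scalemxAr mulmxA -h addrK.
- apply: hmx => v; rewrite !mulmxA -!hT !scalerA.
  by rewrite hp [LHS]linear_underlyingZ mul_mx_scalar.
move=> U hU.
pose W := [pred v : V | (f v <= U)%MS].
have hsub : submod_closed W.
  apply: daha_submod_closed => [|u v|b u|i b u]; rewrite ?inE.
  - by rewrite [f 0](linear0 f) sub0mx.
  - by move=> hu hv; rewrite [f _]linear_underlyingD addmx_sub.
  - by move=> hu; rewrite [f _]linear_underlyingZ scalemx_sub.
  - move=> hu; have hTu := submx_trans (submxMr (T i) hu) (hU i).
    case: b; last by rewrite hT.
    have [_ /(_ u)] := hk i; rewrite scalerDl => /(congr1 f).
    rewrite [LHS]linear_underlyingD [RHS]linear_underlyingZ /= hT addrC => /(canRL (addrK _)) ->.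
    by rewrite addmx_sub // ?scalemx_sub // eqmx_opp.
have [_ /(_ W hsub)[hW|hW]] := hirr.
- left; apply/row_matrixP => i; rewrite row0.
  have := hW (g (row i U)); rewrite inE gK row_sub => /(_ isT)/(congr1 f).
  by rewrite gK [RHS](linear0 f).
right; rewrite -sub1mx; apply/row_subP => i.
by have := hW (g (row i 1%:M)); rewrite inE gK.
Qed.

End Schur.

(** * Identification with E(k_0, k_1, k_2, k_3) *)

Section Model.
Variables (F : fieldType) (q : F) (hq : q != 0) (d : nat) (hd : odd d).
Variables (k : 'Z_4 -> F) (T : 'Z_4 -> 'M[F]_d.+1) (hT : daha_mx q k T).
Variables (v : 'rV[F]_d.+1).
Hypothesis hv0 : v *m T 0 = k 0 *: v.
Hypothesis hv3 : v *m T 3%:R = k 3%:R *: v.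
Hypothesis hk0 : k 0 ^+ 2 = q ^- d.+1.
Hypothesis hend : raising q k T v d.+1 = 0.
Local Notation x := (raising q k T v).
Local Notation P := (span_seq x d.+1).

Lemma raising_E_parameters : E_parameters q d (k 0) (k 1) (k 2%:R) (k 3%:R).
Proof. by split; rewrite ?(dmx_neq0 hT). Qed.

(** The index d + 1 is included, where both sides vanish: at i = d the formulas
involve the next member of the sequence. *)
Lemma E_basis_raising i : (i <= d.+1)%N -> (E_basis F d i)^T *m P = x i.
Proof.
rewrite leq_eqVlt => /orP[/eqP->|hi]; first by rewrite E_basis_out // trmx0 mul0mx.
rewrite -[RHS](rowK x (Ordinal hi)) rowE; congr (_ *m _).
by apply/rowP => r; rewrite !mxE.
Qed.

Lemma E_mx_raising j :
  (E_mx q d (k 0) (k 1) (k 2%:R) (k 3%:R) j)^T *m P = P *m T j.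
Proof.
have hk := raising_E_parameters.
apply/row_matrixP => i; rewrite !row_mul rowK !rowE.
have -> : delta_mx 0 i = (E_basis F d i)^T by apply/rowP => r; rewrite !mxE.
rewrite -trmx_mul.
have hi : (i <= d)%N by rewrite -ltnS.
have hx l : (l <= d.+1)%N -> (E_basis F d l)^T *m P = x l by apply: E_basis_raising.
have hxp : (E_basis F d i.-1)^T *m P = x i.-1 by rewrite hx //; lia.
have hxi : (E_basis F d i)^T *m P = x i by rewrite hx //; lia.
have hxs : (E_basis F d i.+1)^T *m P = x i.+1 by rewrite hx //; lia.
have trD (a b : 'cV_d.+1) : (a + b)^T *m P = a^T *m P + b^T *m P.
  by rewrite linearD mulmxDl.
have trB (a b : 'cV_d.+1) : (a - b)^T *m P = a^T *m P - b^T *m P.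
  by rewrite linearB mulmxBl.
have trZ c (a : 'cV_d.+1) : (c *: a)^T *m P = c *: (a^T *m P).
  by rewrite linearZ -scalemxAl.
elim/Z4_case: j.
- rewrite (E_T0 hq hd hk) (raising_T0 hq hT hv0 hv3).
  by case: ifP => _; rewrite !(trB, trD, trZ) ?hxp ?hxi ?hxs.
- rewrite (E_T1 hq hk) (raising_T1 hq hT hv0 hv3).
  by case: ifP => _; rewrite !(trB, trD, trZ) ?hxp ?hxi ?hxs.
- rewrite (E_T2 q hd) (raising_T2 hq hT hv0 hv3).
  by case: ifP => _; rewrite !(trB, trD, trZ) ?hxp ?hxi ?hxs.
- rewrite (E_T3 q hd) (raising_T3 hq hT hv0 hv3).
  by case: ifP => _; rewrite !(trB, trD, trZ) ?hxp ?hxi ?hxs.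
Qed.

End Model.

Section TwistAction.
Variables (F : fieldType) (q : F) (hq : q != 0) (d : nat) (hd : odd d).
Variables (k0 k1 k2 k3 : F) (hk : E_parameters q d k0 k1 k2 k3) (eps : 'Z_4).
Local Notation E := (twist eps (E_module hq hd hk)).

Lemma twist_E_gen i (w : E) : daha_gen hq i false *: w =
  (E_mx q d k0 k1 k2 k3 (i + eps) *m (w : 'cV[F]_d.+1) : 'cV[F]_d.+1).
Proof.
rewrite -[LHS]/(E_rep hq hd hk (daha_rot hq eps (daha_gen hq i false)) *m _).
by rewrite daha_rot_gen [E_rep _ _ _ _]daha_lift_gen.
Qed.

Lemma twist_E_const (a : F) (w : E) :
  (a%:A : daha hq) *: w = (a *: (w : 'cV[F]_d.+1) : 'cV[F]_d.+1).
Proof.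
rewrite -[LHS]/(E_rep hq hd hk (daha_rot hq eps a%:A) *m _).
by rewrite !linearZ !rmorph1 /= -scalemxAl mul1mx.
Qed.

End TwistAction.

Theorem theorem6p1 (F : closedFieldType) (q : F) (hq : q != 0)
    (hroot : forall n : nat, (0 < n)%N -> q ^+ n != 1)
    (d : nat) (hd : odd d) (V : lmodType (daha hq)) :
  has_dimension d.+1 V ->
  irreducible_module V ->
  exists (eps : 'Z_4) (k0 k1 k2 k3 : F) (hk : E_parameters q d k0 k1 k2 k3),
    isomorphic_modules (twist eps (E_module hq hd hk)) V.
Proof.
have [m hm] : exists m, d = m.*2.+1 by exists d./2; lia.
move: hd; rewrite {d}hm => hd [f fbij] hirr.
have [k [T [hT irr hf]]] := irreducible_daha_mx hirr fbij.
have [|e [k' [v [hT' v0 [hv0 hv3] hk0 hend]]]] :=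
  @daha_mx_classification F q hq m.+1 k T hT irr.
  by rewrite invr_eq1 hroot.
pose T' j := T (j + e).
have hk := raising_E_parameters hT' hk0.
(* T' is V rotated by e, so V itself is the opposite twist of the module E. *)
exists (- e), (k' 0), (k' 1), (k' 2%:R), (k' 3%:R), hk.
pose P := span_seq (raising q k' T' v) m.+1.*2.
have irr' : mx_irreducible T' by apply: mx_irreducible_rot.
have Pu : P \in unitmx.
  rewrite -row_free_unit /row_free rank_span_seq // => a ha.
  exact: (raising_free hq hT' irr' v0 hv0 hv3).
have [g fK gK] := fbij.
pose phi (w : twist (- e) (E_module hq hd hk)) : V :=
  g ((w : 'cV[F]_m.+1.*2)^T *m P).
have phiD : {morph phi : u w / u + w}.
  move=> u w; apply: (can_inj fK); rewrite linear_underlyingD !gK.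
  by rewrite [(_ + _)^T]linearD mulmxDl.
have phiA a w : phi ((a%:A : daha hq) *: w) = (a%:A : daha hq) *: phi w.
  apply: (can_inj fK); rewrite linear_underlyingZ !gK twist_E_const.
  by rewrite linearZ -scalemxAl.
have phit i w : phi (daha_gen hq i false *: w) = daha_gen hq i false *: phi w.
  apply: (can_inj fK); rewrite hf !gK twist_E_gen trmx_mul -!mulmxA.
  rewrite (E_mx_raising hq hd hT' hv0 hv3 hk0 hend).
  by rewrite /T' subrK.
pose phil : {linear twist (- e) (E_module hq hd hk) -> V} :=
  HB.pack phi (GRing.isLinear.Build _ _ _ _ phi (daha_linear_gen phiD phiA phit)).
exists phil; exists (fun u : V => (f u *m invmx P)^T) => [w|u].
  by rewrite -[phil w]/(phi w) gK mulmxK // trmxK.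
by rewrite -[phil _]/(phi _) /phi trmxK mulmxKV // fK.
Qed.
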